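(* The following hardness results hold for $\mathrm{CVPP}_p$: (1) For every $p\in[1,\infty)\setminus 2\mathbb{Z}$ and $\varepsilon>0$, there is no $2^{(1-\varepsilon)n}$-time algorithm for $\mathrm{CVPP}_p$ assuming non-uniform Max-SAT-SETH. In particular, there is no $2^{(1-\varepsilon)n}$-time algorithm for $\mathrm{CVPP}_p$ assuming non-uniform SETH. (2) For every $p\ge 1$, $p\ne 2$, there is no $2^{o(n)}$-time algorithm for $\mathrm{CVPP}_p$ assuming non-uniform Max-SAT-ETH. In particular, there is no $2^{o(n)}$-time algorithm for $\mathrm{CVPP}_p$ assuming non-uniform ETH. (3) For every $\varepsilon>0$, there exists $\gamma(\varepsilon)>1$ such that there is no $2^{(1-\varepsilon)n}$-time algorithm that approximates $\mathrm{CVPP}_\infty$ to within a factor of $\gamma(\varepsilon)$ assuming non-uniform SETH. Here $n$ is the rank of the lattice.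
   Context: For $1\le p<\infty$, $\|\vec x\|_p=(\sum_i|x_i|^p)^{1/p}$ and $\|\vec x\|_\infty=\max_i|x_i|$; $\mathrm{dist}_p(\mathcal{L},\vec t)=\min_{\vec x\in\mathcal{L}}\|\vec x-\vec t\|_p$. A lattice of rank $n$ is $B\mathbb{Z}^n$ for $B\in\mathbb{R}^{d\times n}$ with linearly independent columns. $\mathrm{CVPP}_p$ (Closest Vector Problem with Preprocessing) asks for a preprocessing function $P$ and a query algorithm $Q$: given the lattice (basis $B$), $P$ (of unbounded complexity) outputs a description $P(\mathcal{L})$; given $P(\mathcal{L})$, a target $\vec t$ and $r>0$, $Q$ decides whether $\mathrm{dist}_p(\mathcal{L},\vec t)\le r$. Running time counts only $Q$, and is at least $|P(\mathcal{L})|$. Approximating to within $\gamma$ means distinguishing $\mathrm{dist}\le r$ from $\mathrm{dist}>\gamma r$. Non-uniform ETH: no family of circuits of size $2^{o(n)}$ solves 3-SAT on $n$ variables. Non-uniform SETH: for every $\varepsilon>0$ there is $k$ such that no family of circuits of size $2^{(1-\varepsilon)n}$ solves $k$-SAT on $n$ variables. Non-uniform Max-SAT-SETH and Max-SAT-ETH are the same hypotheses with $k$-SAT (resp. 3-SAT) replaced by Max-$k$-SAT (resp. Max-3-SAT): given a CNF formula and integer $W$, decide whether some assignment satisfies at least $W$ clauses. *)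

(* Defs.v *)
From HB Require Import structures.
From mathcomp Require Import all_boot all_order all_algebra.
From mathcomp Require Import all_classical all_reals all_analysis.

Set Implicit Arguments.
Unset Strict Implicit.
Unset Printing Implicit Defensive.

Import Order.TTheory GRing.Theory Num.Theory.
Import numFieldNormedType.Exports.

Local Open Scope classical_set_scope.
Local Open Scope ring_scope.

(** * Lattices, norms, distance *)

Definition lpnorm (R : realType) (p : R) (d : nat) (x : 'cV[R]_d) : R :=
  (\sum_(i < d) `|x i 0| `^ p) `^ p^-1.

Definition linfnorm (R : realType) (d : nat) (x : 'cV[R]_d) : R :=
  \big[Num.max/0]_(i < d) `|x i 0|.

Definition lattice_basis (R : realType) (d n : nat) (B : 'M[R]_(d, n)) : bool :=
  row_free B^T.

Definition lattice (R : realType) (d n : nat) (B : 'M[R]_(d, n)) : set 'cV[R]_d :=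
  [set B *m map_mx intr z | z in [set: 'cV[int]_n]].

(* A lattice is discrete, so the infimum is attained: it is the minimum. *)
Definition dist (R : realType) (N : forall d, 'cV[R]_d -> R) (d : nat)
    (L : set 'cV[R]_d) (t : 'cV[R]_d) : R :=
  inf [set N d (x - t) | x in L].

(** * Boolean circuits *)

(* A circuit is a straight-line program over the basis of all binary Boolean
   functions.  Wires are numbered from 0, first the inputs and then the gates
   in order (an index that is not yet defined reads false); the output is the
   last wire.  The size is the number of gates. *)
Record gate := Gate { gate_in1 : nat; gate_in2 : nat; gate_op : bool -> bool -> bool }.

Definition circuit := seq gate.

Definition gate_eval (wires : seq bool) (g : gate) : seq bool :=
  rcons wires (gate_op g (nth false wires (gate_in1 g)) (nth false wires (gate_in2 g))).

Definition circuit_eval (C : circuit) (input : seq bool) : bool :=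
  last false (foldl gate_eval input C).

(** * Satisfiability *)

(* The literal (i, b) is satisfied when variable i has value b. *)
Definition literal (n : nat) : finType := ('I_n * bool)%type.

Definition kclause (n k : nat) : finType := {C : {set literal n} | (#|C| <= k)%N}.

Definition kcnf (n k : nat) : finType := {set kclause n k}.

Definition clause_sat (n k : nat) (a : {ffun 'I_n -> bool}) (C : kclause n k) : bool :=
  [exists l : literal n, (l \in val C) && (a l.1 == l.2)].

Definition satisfiable (n k : nat) (F : kcnf n k) : bool :=
  [exists a : {ffun 'I_n -> bool}, [forall C in F, clause_sat a C]].

Definition max_satisfiable (n k : nat) (F : kcnf n k) (W : nat) : bool :=
  [exists a : {ffun 'I_n -> bool}, (W <= #|[set C in F | clause_sat a C]%SET|)%N].

(* For fixed k a formula is given by one bit for each of the polynomially many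
   possible clauses. *)
Definition enc_kcnf (n k : nat) (F : kcnf n k) : seq bool :=
  [seq C \in F | C <- enum (kclause n k)].

(* Binary digits, least significant first. *)
Definition bits_width (w m : nat) : seq bool := mkseq (fun i => odd (m %/ 2 ^ i)) w.

Definition bits (m : nat) : seq bool := bits_width (trunc_log 2 m).+1 m.

Definition threshold_width (n k : nat) : nat := (trunc_log 2 #|kclause n k|).+1.

Definition solves_kSAT (k : nat) (C : nat -> circuit) : Prop :=
  forall (n : nat) (F : kcnf n k), circuit_eval (C n) (enc_kcnf F) = satisfiable F.

Definition solves_MaxkSAT (k : nat) (C : nat -> circuit) : Prop :=
  forall (n : nat) (F : kcnf n k) (W : nat), (W <= #|kclause n k|)%N ->
    circuit_eval (C n) (enc_kcnf F ++ bits_width (threshold_width n k) W)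
      = max_satisfiable F W.

(** * Non-uniform hypotheses *)

Definition is_two_pow_o (R : realType) (tau : nat -> R) : Prop :=
  exists f : nat -> R,
    ((fun n => f n / n%:R) @ \oo --> (0 : R)) /\ (forall n, tau n = 2 `^ f n).

Definition seth_for (R : realType) (solves : nat -> (nat -> circuit) -> Prop) : Prop :=
  forall eps : R, 0 < eps -> exists k : nat,
    ~ exists C : nat -> circuit, solves k C /\
        (\forall n \near \oo, (size (C n))%:R <= (2 : R) `^ ((1 - eps) * n%:R)).

Definition eth_for (R : realType) (solves : nat -> (nat -> circuit) -> Prop) : Prop :=
  ~ exists (C : nat -> circuit) (tau : nat -> R),
      [/\ solves 3 C, is_two_pow_o tau & forall n, (size (C n))%:R <= tau n].

Definition SETH (R : realType) : Prop := seth_for R solves_kSAT.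
Definition MaxSAT_SETH (R : realType) : Prop := seth_for R solves_MaxkSAT.
Definition ETH (R : realType) : Prop := eth_for R solves_kSAT.
Definition MaxSAT_ETH (R : realType) : Prop := eth_for R solves_MaxkSAT.

(** * Multitape Turing machines *)

(* Input strings are over the alphabet {0, 1, #}: Some b is the bit b, and None
   is the separator #. *)
Definition insym : finType := option bool.

Inductive move := MoveLeft | MoveStay | MoveRight.

Definition shift_of (m : move) : int :=
  match m with MoveLeft => -1 | MoveStay => 0 | MoveRight => 1 end.

(* A deterministic machine with tm_extra + 2 two-way infinite tapes.  A cell holds
   None (blank), Some (inl x) for an input symbol x, or Some (inr y) for a working
   symbol y.  tm_out s is None when s is not a halting state; otherwise it is the
   answer. *)
Record tm := Tm {
  tm_state : finType;
  tm_work : finType;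
  tm_extra : nat;
  tm_start : tm_state;
  tm_out : tm_state -> option bool;
  tm_delta : tm_state -> {ffun 'I_tm_extra.+2 -> option (insym + tm_work)} ->
    tm_state * ('I_tm_extra.+2 -> option (insym + tm_work) * move) }.

Definition tm_cell (M : tm) : Type := option (insym + tm_work M).

Record tm_config (M : tm) := TmConfig {
  cfg_state : tm_state M;
  cfg_tape : 'I_(tm_extra M).+2 -> int -> tm_cell M;
  cfg_head : 'I_(tm_extra M).+2 -> int }.

Definition tm_step (M : tm) (c : tm_config M) : tm_config M :=
  if tm_out (cfg_state c) is Some _ then c else
  let: (s, act) := tm_delta (cfg_state c) [ffun i => cfg_tape c i (cfg_head c i)] in
  TmConfig s
    (fun i z => if z == cfg_head c i then (act i).1 else cfg_tape c i z)
    (fun i => cfg_head c i + shift_of (act i).2).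

Definition tape_of_string (M : tm) (x : seq insym) (z : int) : tm_cell M :=
  match z with
  | Posz m => nth None [seq Some (inl a) | a <- x] m
  | Negz _ => None
  end.

(* Tape 0 holds x, tape 1 holds y, the other tapes are blank, and every head is on
   cell 0. *)
Definition tm_init (M : tm) (x y : seq insym) : tm_config M :=
  TmConfig (tm_start M)
    (fun i => tape_of_string M (nth [::] [:: x; y] i))
    (fun=> 0).

Definition tm_halts_within (M : tm) (x y : seq insym) (T : nat) (b : bool) : Prop :=
  tm_out (cfg_state (iter T (@tm_step M) (tm_init M x y))) = Some b.

(** * The closest vector problem with preprocessing *)

(* Sign bit, numerator and denominator in lowest terms, in binary. *)
Definition enc_rat (q : rat) : seq insym :=
  Some (numq q < 0) :: map Some (bits `|numq q|%N)
    ++ None :: map Some (bits `|denq q|%N) ++ [:: None].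

Definition enc_mx (m n : nat) (A : 'M[rat]_(m, n)) : seq insym :=
  flatten [seq enc_rat (A ij.1 ij.2) | ij <- enum {: 'I_m * 'I_n}].

(* There are a preprocessing function P, with no condition of computability, and a
   query machine Q which together approximate CVPP in the norm N to within a factor
   gamma (gamma = 1 is the exact decision problem), in time tau(n) up to a
   polynomial factor in the bit length of the instance, n being the rank.  An input
   may be arbitrarily long for a given n, so that without this factor no machine
   could even read its input.  A constant factor is absorbed by the exponent e, as
   the bit length is at least 5.  The running time is at least the length of the
   description P(L). *)
Definition CVPP_algorithm (R : realType) (N : forall d, 'cV[R]_d -> R)
    (gamma : R) (tau : nat -> R) : Prop :=
  exists (P : forall d n, 'M[rat]_(d, n) -> seq bool) (Q : tm) (e : nat),
  forall (d n : nat) (B : 'M[rat]_(d, n)) (t : 'cV[rat]_d) (r : rat),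
    let BR : 'M[R]_(d, n) := map_mx ratr B in
    let D : R := dist N (lattice BR) (map_mx ratr t) in
    let len := (size (enc_mx B) + size (enc_mx t) + size (enc_rat r))%N in
    lattice_basis BR -> 0 < r ->
    exists (T : nat) (b : bool),
      [/\ (size (P d n B) <= T)%N,
          T%:R <= tau n * len%:R ^+ e,
          tm_halts_within Q (map Some (P d n B)) (enc_mx t ++ enc_rat r) T b,
          D <= ratr r -> b = true
        & gamma * ratr r < D -> b = false].

(* Main.v *)
Require Import Defs.
From HB Require Import structures.
From mathcomp Require Import all_boot all_order all_algebra.
From mathcomp Require Import all_classical all_reals all_analysis.
From mathcomp Require Import zify ring lra.

Set Implicit Arguments.
Unset Strict Implicit.
Unset Printing Implicit Defensive.

Import Order.TTheory GRing.Theory Num.Theory.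
Import numFieldNormedType.Exports.

Local Open Scope classical_set_scope.
Local Open Scope ring_scope.

(** The lattice depends only on the number n of variables and on k: it contains
    rows for every possible k-clause, and the formula only chooses the target.  Rows
    2 A x_i - A with A large force x to be a 0/1 vector.  A clause with w satisfied
    literals contributes rows c w - t, where t is one of two integers according to
    whether the clause belongs to the formula.

    For the p-norm the two lists of targets are such that switching a clause on changes
    the cost by about 0 if w > 0, and by some g > 0 if w = 0.  If p is not an even
    integer, this comes from the singularity of |t|^p at 0: an integer combination of the
    functions t |-> |c w - 2^i t|^p + |c w + 2^i t|^p which annihilates the even powers
    of t up to an order above p is small for w > 0, where the function is analytic in t, but
    not for w = 0.  If p >= 4 is even, all polynomials in w of degree 3 are obtained
    exactly.  The cost of the clauses that are switched off is constant, by symmetry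
    under sign changes, because all clauses are present.  In the maximum norm the targets
    r + 1 and r work, for a radius r > k.

    The query machine is turned into a circuit of size O(T log T): to run 2 L steps on a
    window of six blocks of length L around each head, cut out three blocks around the
    head, run L steps, put the blocks back, and repeat once.  A circuit of size T^2
    would be too large for the SETH bounds. *)

(** * Circuits with structured inputs and outputs *)

(** Non-uniformity pays for the preprocessing: for given n and k the description of the lattice is
    one string, hardwired into the circuit for n. The lattice and the radius may depend on n, k and
    a threshold; the bits of the formula enter through the target only. The length of the query must
    not depend on the formula either, so that every tape cell is a function of one bit. In the
    p-norm the two targets of a row may have encodings of different lengths; the auxiliary rows that
    balance them shift the cost by what the all-false assignment would pay. A query therefore sees
    the number of satisfied clauses relative to the all-false assignment, and asks whether some
    assignment gains at least theta clauses. The clauses satisfied by the all-false assignment are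
    counted separately, and each of the polynomially many thresholds gets its own query circuit. For
    even p the cost of switching a clause on is a polynomial in w of degree less than p. It has to
    vanish at 1, ..., k and not at 0, so k < p. This is why even p occurs only with k = 3, and why p
    = 2 is beyond this gadget. *)

(* Inputs and outputs are families of wires indexed by arbitrary types, so that
   rearranging, duplicating or discarding wires is free. *)
Definition computable (I J : Type) (s : nat) (f : (I -> bool) -> J -> bool) : Prop :=
  forall (N : nat) (idx : I -> nat), (forall i, idx i < N)%N ->
  exists (C : circuit) (out : J -> nat),
    [/\ (size C <= s)%N, forall j, (out j < N + size C)%N &
      forall W : seq bool, size W = N -> forall j,
        nth false (foldl gate_eval W C) (out j) = f (fun i => nth false W (idx i)) j].

Lemma size_run (C : circuit) (W : seq bool) :
  size (foldl gate_eval W C) = (size W + size C)%N.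
Proof.
elim: C W => [|g C IH] W /=; first by rewrite addn0.
by rewrite IH size_rcons addSnnS.
Qed.

Lemma nth_run (C : circuit) (W : seq bool) (i : nat) : (i < size W)%N ->
  nth false (foldl gate_eval W C) i = nth false W i.
Proof.
elim: C W => [|g C IH] W //= ltiW.
by rewrite IH ?size_rcons ?leqW // nth_rcons ltiW.
Qed.

Lemma computable_ext (I J : Type) (s : nat) (f g : (I -> bool) -> J -> bool) :
  computable s f -> (forall v j, f v j = g v j) -> computable s g.
Proof.
move=> cf fg N idx ltN; have [C [out [sC ltout HC]]] := cf N idx ltN.
by exists C, out; split=> // W sW j; rewrite HC.
Qed.

Lemma computable_le (I J : Type) (s t : nat) (f : (I -> bool) -> J -> bool) :
  computable s f -> (s <= t)%N -> computable t f.
Proof.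
move=> cf st N idx ltN; have [C [out [sC ltout HC]]] := cf N idx ltN.
by exists C, out; split=> //; apply: leq_trans st.
Qed.

Lemma computable_wire (I J : Type) (h : J -> I) : computable 0 (fun v j => v (h j)).
Proof.
by move=> N idx ltN; exists [::], (idx \o h); split=> // j; rewrite addn0 /=.
Qed.

Lemma computable_comp (I J L : Type) (s t : nat) (f : (I -> bool) -> J -> bool)
    (g : (J -> bool) -> L -> bool) :
  computable s f -> computable t g -> computable (s + t) (fun v => g (f v)).
Proof.
move=> cf cg N idx ltN; have [C [out [sC ltout HC]]] := cf N idx ltN.
have [D [out' [sD ltout' HD]]] := cg _ out ltout.
exists (C ++ D), out'; split=> [|j|W sW j].
- by rewrite size_cat leq_add.
- by rewrite size_cat addnA.
rewrite foldl_cat HD ?size_run ?sW //; congr g.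
by apply/funext => i; rewrite HC.
Qed.

Lemma computable_keep (I J : Type) (s : nat) (f : (I -> bool) -> J -> bool) :
  computable s f ->
  computable s (fun v (x : I + J) => match x with inl i => v i | inr j => f v j end).
Proof.
move=> cf N idx ltN; have [C [out [sC ltout HC]]] := cf N idx ltN.
exists C, (fun x => match x with inl i => idx i | inr j => out j end); split=> //.
  by case=> // i; rewrite ltn_addr.
by move=> W sW [i|j]; [rewrite nth_run ?sW | rewrite HC].
Qed.

Lemma computable_pair (I J L : Type) (s t : nat) (f : (I -> bool) -> J -> bool)
    (g : (I -> bool) -> L -> bool) : computable s f -> computable t g ->
  computable (s + t) (fun v (x : J + L) => match x with inl j => f v j | inr l => g v l end).
Proof.
move=> cf cg N idx ltN; have [C [out [sC ltout HC]]] := cf N idx ltN.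
have ltN' i : (idx i < N + size C)%N by rewrite ltn_addr.
have [D [out' [sD ltout' HD]]] := cg _ idx ltN'.
exists (C ++ D), (fun x => match x with inl i => out i | inr j => out' j end); split.
- by rewrite size_cat leq_add.
- by rewrite size_cat addnA; case=> // j; rewrite ltn_addr.
move=> W sW [j|l]; rewrite foldl_cat.
  by rewrite nth_run ?HC // size_run sW.
rewrite HD ?size_run ?sW //; congr g.
by apply/funext => i; rewrite nth_run ?sW.
Qed.

Lemma computable_gate (op : bool -> bool -> bool) :
  computable 1 (fun v (_ : unit) => op (v true) (v false)).
Proof.
move=> N idx ltN; exists [:: Gate (idx true) (idx false) op], (fun=> N); split=> //.
  by rewrite addn1.
by move=> W sW j /=; rewrite /gate_eval /= nth_rcons sW ltnn eqxx.
Qed.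

Lemma computable_op (I : Type) (op : bool -> bool -> bool) (s t : nat)
    (f g : (I -> bool) -> unit -> bool) : computable s f -> computable t g ->
  computable (s + t).+1 (fun v (_ : unit) => op (f v tt) (g v tt)).
Proof.
move=> cf cg; rewrite -addn1.
have cw := computable_wire (fun b : bool => if b then inl tt else inr tt : unit + unit).
have := computable_comp (computable_comp (computable_pair cf cg) cw) (computable_gate op).
by rewrite addn0.
Qed.

Lemma computable_const (I : Type) (b : bool) :
  computable 1 (fun (v : I -> bool) (_ : unit) => b).
Proof.
move=> N idx ltN; exists [:: Gate 0 0 (fun _ _ => b)], (fun=> N); split=> //.
  by rewrite addn1.
by move=> W sW j /=; rewrite /gate_eval /= nth_rcons sW ltnn eqxx.
Qed.

Lemma computable_mux (I : Type) (i : I) (s t : nat)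
    (f g : (I -> bool) -> unit -> bool) : computable s f -> computable t g ->
  computable (s + t + 3) (fun v (_ : unit) => if v i then f v tt else g v tt).
Proof.
move=> cf cg; have cw := computable_wire (fun _ : unit => i).
have c1 := computable_op andb cw cf.
have c2 := computable_op (fun x y => ~~ x && y) cw cg.
have := computable_op orb c1 c2.
rewrite !add0n addSn addnS -addn3 => c; refine (computable_ext c _) => v _.
by case: (v i) => //=; rewrite orbF.
Qed.

Lemma computable_or (I : Type) (l : seq I) :
  computable (size l).+1 (fun v (_ : unit) => has v l).
Proof.
elim: l => [|i l IH]; first by refine (computable_ext (@computable_const I false) _).
refine (computable_ext (computable_op orb (computable_wire (fun _ : unit => i)) IH) _).
by [].
Qed.

Lemma computable_has (I : Type) (T : Type) (l : seq T) (s : nat)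
    (f : T -> (I -> bool) -> bool) :
  (forall x, computable s (fun v (_ : unit) => f x v)) ->
  computable (size l * s.+1).+1 (fun v (_ : unit) => has (fun x => f x v) l).
Proof.
move=> cf; elim: l => [|x l IH]; first by refine (computable_ext (@computable_const I false) _).
refine (computable_le (computable_op orb (cf x) IH) _) => /=.
by rewrite mulSn; lia.
Qed.

Lemma computable_all (I : Type) (T : Type) (l : seq T) (s : nat)
    (f : T -> (I -> bool) -> bool) :
  (forall x, computable s (fun v (_ : unit) => f x v)) ->
  computable (size l * s.+1).+1 (fun v (_ : unit) => all (fun x => f x v) l).
Proof.
move=> cf; elim: l => [|x l IH]; first by refine (computable_ext (@computable_const I true) _).
refine (computable_le (computable_op andb (cf x) IH) _) => /=.
by rewrite mulSn; lia.
Qed.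

Lemma computable_family (I : Type) (J : finType) (s : nat)
    (f : (I -> bool) -> J -> bool) :
  (forall j, computable s (fun v (_ : unit) => f v j)) -> computable (#|J| * s) f.
Proof.
move=> cf N idx ltN.
suff H : forall l : seq J, exists (C : circuit) (out : J -> nat),
    [/\ (size C <= size l * s)%N, forall j, j \in l -> (out j < N + size C)%N &
      forall W : seq bool, size W = N -> forall j, j \in l ->
        nth false (foldl gate_eval W C) (out j) = f (fun i => nth false W (idx i)) j].
  have [C [out [sC ltout HC]]] := H (enum J).
  exists C, out; split=> [|j|W sW j]; first by rewrite cardE.
    by rewrite ltout ?mem_enum.
  by rewrite HC ?mem_enum.
elim=> [|j0 l [C [out [sC ltout HC]]]]; first by exists [::], (fun=> 0).
have ltN' i : (idx i < N + size C)%N by rewrite ltn_addr.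
have [D [out' [sD ltout' HD]]] := cf j0 _ idx ltN'.
exists (C ++ D), (fun j => if j \in l then out j else out' tt); split.
- by rewrite size_cat /= mulSn addnC leq_add.
- move=> j _; rewrite size_cat addnA; case: ifP => [/ltout /ltn_addr->//|_].
  exact: ltout'.
move=> W sW j; rewrite inE foldl_cat; case: ifP => [jl _|_].
  by rewrite nth_run ?HC // size_run sW ltout.
rewrite orbF => /eqP ->; rewrite HD ?size_run ?sW //; congr f.
by apply/funext => i; rewrite nth_run ?sW.
Qed.

(** Shannon expansion: multiplexing over one input at a time gives the sizes s(0) = 1 and s(m+1) = 2
    s(m) + 3, that is 4 * 2^m - 3. *)
Lemma computable_finite (I : finType) (f : (I -> bool) -> bool) :
  computable (4 * 2 ^ #|I|) (fun v (_ : unit) => f v).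
Proof.
suff H : forall (l : seq I) (f : (I -> bool) -> bool),
    (forall v w, {in l, v =1 w} -> f v = f w) ->
    computable (4 * 2 ^ size l - 3) (fun v (_ : unit) => f v).
  rewrite cardE; refine (computable_le (H (enum I) f _) _); last exact: leq_subr.
  move=> v w vw; congr f; apply/funext => i; apply: vw; exact: mem_enum.
elim=> [|i l IH] g Hg.
  refine (computable_ext (@computable_const I (g (fun=> false))) _) => v _.
  exact: Hg.
pose upd b (v : I -> bool) := fun j => if j == i then b else v j.
have Hu b : computable (4 * 2 ^ size l - 3) (fun v (_ : unit) => g (upd b v)).
  apply: (IH (g \o upd b)) => v w vw; apply: Hg => j.
  by rewrite inE /upd; case: eqP => //= _ jl; apply: vw.
have := computable_mux i (Hu true) (Hu false).
have le1 : (4 <= 4 * 2 ^ size l)%N by rewrite leq_pmulr ?expn_gt0.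
rewrite /= expnS => H; refine (computable_le (computable_ext H _) _); last by lia.
move=> v _ /=; case Ev: (v i); apply: Hg => j _; rewrite /upd; case: eqP => // ->//.
Qed.

(** For [K] of bounded size the cost is linear in the number of outputs. Cutting and pasting windows
    of tape cells is of this kind. *)
Lemma computable_local (I : Type) (J K : finType) (h : J -> K -> I)
    (g : J -> (K -> bool) -> bool) :
  computable (#|J| * (4 * 2 ^ #|K|)) (fun v j => g j (fun k => v (h j k))).
Proof.
apply: computable_family => j.
by have := computable_comp (computable_wire (h j)) (computable_finite (g j)).
Qed.

Lemma computable_circuit (m s : nat) (f : ('I_m -> bool) -> bool) :
  computable s (fun v (_ : unit) => f v) ->
  exists2 C : circuit, (size C <= s.+1)%N &
    forall W, size W = m -> circuit_eval C W = f (fun i => nth false W i).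
Proof.
move=> /(_ m (@nat_of_ord m) (@ltn_ord m)) [C [out [sC ltout HC]]].
(* [circuit_eval] reads the last wire, so a gate that copies the output is appended. *)
exists (rcons C (Gate (out tt) 0 (fun x _ => x))); first by rewrite size_rcons.
move=> W sW; rewrite /circuit_eval foldl_rcons /gate_eval last_rcons /=.
by rewrite HC.
Qed.

(** * Simulation of Turing machines by circuits *)

Lemma head_iter (M : tm) (c : tm_config M) (t : nat) i :
  cfg_head c i - t%:Z <= cfg_head (iter t (@tm_step M) c) i <= cfg_head c i + t%:Z.
Proof.
elim: t => [|t IH] /=; first by lia.
move: IH; set c' := iter t _ c => IH.
rewrite /tm_step; case: (tm_out _) => [b|]; first by lia.
case: (tm_delta _ _) => s act /=.
by case: (act i).2 => /=; lia.
Qed.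

(** A step writes before it moves, so [t] steps touch only cells at distance less than [t] from the
    head. *)
Lemma tape_iter (M : tm) (c : tm_config M) (t : nat) i (z : int) :
  (z <= cfg_head c i - t%:Z) || (cfg_head c i + t%:Z <= z) ->
  cfg_tape (iter t (@tm_step M) c) i z = cfg_tape c i z.
Proof.
elim: t => [//|t IH] Hz /=; have := head_iter c t i.
rewrite -IH; last by lia.
set c' := iter t _ c.
rewrite /tm_step; case: (tm_out _) => [//|].
case: (tm_delta _ _) => s act /= Hh.
by case: eqP => // E; lia.
Qed.

Lemma halted_iter (M : tm) (c : tm_config M) (T T' : nat) (b : bool) : (T <= T')%N ->
  tm_out (cfg_state (iter T (@tm_step M) c)) = Some b ->
  tm_out (cfg_state (iter T' (@tm_step M) c)) = Some b.
Proof.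
move=> /subnK <-; elim: (T' - T)%N => [//|m IH] /= H.
by have := IH H; set c' := iter _ _ c => E; rewrite /tm_step E E.
Qed.

(* A tape symbol together with a mark telling whether the head is there. *)
Definition marked_cell (M : tm) : finType := (option (insym + tm_work M) * bool)%type.

(* Wires for the one-hot encoding of the state and of 3 L cells of each tape. *)
Definition window (M : tm) (L : nat) : finType :=
  (tm_state M + 'I_(tm_extra M).+2 * 'I_(3 * L) * marked_cell M)%type.

Definition view (M : tm) (L : nat) (c : tm_config M) (o : 'I_(tm_extra M).+2 -> int)
    (x : window M L) : bool :=
  match x with
  | inl s => cfg_state c == s
  | inr (i, z, a) =>
      (cfg_tape c i (o i + (z : nat)%:Z), o i + (z : nat)%:Z == cfg_head c i) == a
  end.

Definition heads_within (M : tm) (c : tm_config M) (o : 'I_(tm_extra M).+2 -> int)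
    (a b : nat) : Prop :=
  forall i, o i + a%:Z <= cfg_head c i < o i + b%:Z.

(** One circuit serves all configurations and all origins [o], since it sees only the view. A head
    that starts in the middle third cannot leave the [3 * L] cells within [L] steps. *)
Definition simulates (M : tm) (L s : nat) : Prop :=
  exists2 f : (window M L -> bool) -> window M L -> bool, computable s f &
    forall c o, heads_within c o L (2 * L) ->
      f (view c o) = view (iter L (@tm_step M) c) o.

Lemma view_step_local (M : tm) (c c' : tm_config M) o o' :
  heads_within c o 1 2 -> heads_within c' o' 1 2 ->
  @view M 1 c o = @view M 1 c' o' ->
  @view M 1 (tm_step c) o = @view M 1 (tm_step c') o'.
Proof.
move=> hc hc' E.
have Es : cfg_state c = cfg_state c'.
  have /= := congr1 (@^~ (inl (cfg_state c))) E.
  by rewrite eqxx => /esym/eqP.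
have Eh i : cfg_head c i = o i + 1 by have := hc i; lia.
have Eh' i : cfg_head c' i = o' i + 1 by have := hc' i; lia.
have Et i (z : 'I_3) : cfg_tape c i (o i + (z : nat)%:Z) = cfg_tape c' i (o' i + (z : nat)%:Z).
  have /= := congr1 (@^~ (inr (i, z, (cfg_tape c i (o i + (z : nat)%:Z),
    o i + (z : nat)%:Z == cfg_head c i)))) E.
  by rewrite eqxx => /esym/eqP[->].
rewrite /tm_step -Es; case: (tm_out _) => [//|].
have -> : [ffun i => cfg_tape c' i (cfg_head c' i)] = [ffun i => cfg_tape c i (cfg_head c i)].
  apply/ffunP => i; rewrite !ffunE Eh Eh'.
  by have /= := Et i (Ordinal (isT : (1 < 3)%N)) => ->.
case: (tm_delta _ _) => s act; apply/funext => -[s'|[[i z] a]] //=.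
by rewrite Et Eh Eh' -!addrA !(inj_eq (addrI _)).
Qed.

(** There are finitely many views of three cells per tape, and by [view_step_local] each determines
    its successor, whichever configuration it comes from. So one step is a fixed finite table. *)
Lemma simulates_one (M : tm) :
  exists s, simulates M 1 s.
Proof.
pose f (v : window M 1 -> bool) (j : window M 1) : bool :=
  `[< exists c o, [/\ heads_within c o 1 2, v = view c o & view (tm_step c) o j] >].
exists (#|window M 1| * (4 * 2 ^ #|window M 1|))%N, f.
  exact: (computable_local (fun (_ : window M 1) k => k) (fun j v => f v j)).
move=> c o hc; apply/funext => j; apply/asboolP/idP => [|H].
  by move=> [c' [ o' [hc' E H]]]; rewrite /= (view_step_local hc hc' E).
by exists c, o.
Qed.

(** * Cutting three blocks out of six and putting them back *)

Lemma block_pos_subproof (L : nat) (b : 'I_4) (z : 'I_(3 * L)) :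
  (b * L + z < 3 * (L + L))%N.
Proof.
have : (b * L <= 3 * L)%N by rewrite leq_mul2r -ltnS ltn_ord orbT.
by have := ltn_ord z; lia.
Qed.

Definition block_pos (L : nat) (b : 'I_4) (z : 'I_(3 * L)) : 'I_(3 * (L + L)) :=
  Ordinal (block_pos_subproof b z).

(** [b] numbers the four triples of consecutive blocks among the six. Triple [b] is the one to cut
    out when the head is in its middle block, which is block [b + 1]. *)
Definition head_wires (M : tm) (L : nat) (i : 'I_(tm_extra M).+2) (b : 'I_4) :
    seq (window M (L + L)) :=
  [seq inr (i, z, (a, true)) | z <- [seq z : 'I_(3 * (L + L)) <- enum 'I_(3 * (L + L)) |
     (b.+1 * L <= (z : nat) < b.+2 * L)%N], a <- enum (option (insym + tm_work M) : finType)].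

Lemma head_wiresP (M : tm) (L : nat) (c : tm_config M) o i (b : 'I_4) :
  has (@view M (L + L) c o) (@head_wires M L i b) =
  (o i + (b.+1 * L)%:Z <= cfg_head c i < o i + (b.+2 * L)%:Z).
Proof.
apply/hasP/idP => [|H].
  move=> [x /allpairsP[[z a] [/= zin _ ->]] /= /eqP[_ /eqP Eh]].
  by move: zin; rewrite mem_filter -Eh => /andP[Hz _]; lia.
have Lb : (b.+2 * L <= 5 * L)%N by rewrite leq_mul2r ltnS ltn_ord orbT.
have ltz : (`|cfg_head c i - o i|%N < 3 * (L + L))%N by lia.
pose z := Ordinal ltz.
exists (inr (i, z, (cfg_tape c i (cfg_head c i), true))).
  apply/allpairsP; exists (z, cfg_tape c i (cfg_head c i)); split=> //=.
    by rewrite mem_filter mem_enum andbT /=; lia.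
  by rewrite mem_enum.
have Ez : o i + (z : nat)%:Z = cfg_head c i by rewrite /=; lia.
by rewrite /view Ez eqxx.
Qed.

Lemma size_head_wires (M : tm) (L : nat) i (b : 'I_4) :
  (size (@head_wires M L i b) <= 6 * L * #|(option (insym + tm_work M) : finType)|)%N.
Proof.
rewrite size_allpairs -cardE leq_mul2r size_filter; apply/orP; right.
by apply: leq_trans (count_size _ _) _; rewrite size_enum_ord; lia.
Qed.

Lemma card_window (M : tm) (L : nat) : (0 < L)%N ->
  (#|window M L| <= (#|tm_state M| + (tm_extra M).+2 * 3 * #|marked_cell M|) * L)%N.
Proof.
move=> L0; rewrite card_sum !card_prod !card_ord mulnDl leq_add ?leq_pmulr //.
by have : forall a b c : nat, (a * b * c * L = a * (b * L) * c)%N by [lia]; move=> ->.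
Qed.

Definition select_block (M : tm) (L : nat)
    (u : window M (L + L) + 'I_(tm_extra M).+2 * 'I_4 -> bool) (x : window M L) : bool :=
  match x with
  | inl s => u (inl (inl s))
  | inr (i, z, a) => [exists b : 'I_4, u (inr (i, b)) && u (inl (inr (i, block_pos b z, a)))]
  end.

(** For [y < b * L] the truncated difference is 0, which [insub] accepts; hence the separate test
    [b * L <= y]. *)
Definition restore_block (M : tm) (L : nat)
    (u : (window M (L + L) + 'I_(tm_extra M).+2 * 'I_4) + window M L -> bool)
    (x : window M (L + L)) : bool :=
  match x with
  | inl s => u (inr (inl s))
  | inr (i, y, a) => [exists b : 'I_4, u (inl (inr (i, b))) &&
      (if insub (y - b * L)%N is Some z then
         u (if (b * L <= y)%N then inr (inr (i, z, a)) else inl (inl (inr (i, y, a))))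
       else u (inl (inl (inr (i, y, a)))))]
  end.

(** An output depends on eight wires: four selectors and one candidate for each of the four
    triples. *)
Lemma computable_select_block (M : tm) (L : nat) :
  computable (#|window M L| * (4 * 2 ^ 8)) (@select_block M L).
Proof.
pose h (x : window M L) (k : 'I_4 + 'I_4) : window M (L + L) + 'I_(tm_extra M).+2 * 'I_4 :=
  match x with
  | inl s => inl (inl s)
  | inr (i, z, a) => match k with
      inl b => inr (i, b) | inr b => inl (inr (i, block_pos b z, a)) end
  end.
pose g (x : window M L) (u : 'I_4 + 'I_4 -> bool) : bool :=
  if x is inl _ then u (inl ord0) else [exists b, u (inl b) && u (inr b)].
have e8 : #|(('I_4 + 'I_4)%type : finType)| = 8 by rewrite card_sum card_ord.
have := computable_local h g; rewrite e8 => c.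
by refine (computable_ext c _) => v [s|[[i z] a]].
Qed.

Lemma computable_restore_block (M : tm) (L : nat) :
  computable (#|window M (L + L)| * (4 * 2 ^ 8)) (@restore_block M L).
Proof.
pose h (x : window M (L + L)) (k : 'I_4 + 'I_4) :
    (window M (L + L) + 'I_(tm_extra M).+2 * 'I_4) + window M L :=
  match x with
  | inl s => inr (inl s)
  | inr (i, y, a) => match k with
    | inl b => inl (inr (i, b))
    | inr b => if insub (y - b * L)%N is Some z then
         (if (b * L <= y)%N then inr (inr (i, z, a)) else inl (inl (inr (i, y, a))))
       else inl (inl (inr (i, y, a))) end
  end.
pose g (x : window M (L + L)) (u : 'I_4 + 'I_4 -> bool) : bool :=
  if x is inl _ then u (inl ord0) else [exists b, u (inl b) && u (inr b)].
have e8 : #|(('I_4 + 'I_4)%type : finType)| = 8 by rewrite card_sum card_ord.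
have := computable_local h g; rewrite e8 => c.
refine (computable_ext c _) => v [s|[[i y] a]] //=.
by apply: eq_existsb => b; case: insub.
Qed.

Definition block_cost (M : tm) : nat :=
  ((tm_extra M).+2 * 4 * (6 * #|(option (insym + tm_work M) : finType)|).+1 +
   (#|tm_state M| + (tm_extra M).+2 * 3 * #|marked_cell M|) * 3 * (4 * 2 ^ 8))%N.

(* On each tape, three blocks of length L around the head are cut out of the six
   blocks of the window, and put back after L steps. *)
Lemma simulates_half (M : tm) (L s : nat) : (0 < L)%N -> simulates M L s ->
  exists2 f : (window M (L + L) -> bool) -> window M (L + L) -> bool,
    computable (s + block_cost M * L) f &
    forall c o, heads_within c o L (5 * L) ->
      f (view c o) = view (iter L (@tm_step M) c) o.
Proof.
move=> L0 [f cf Hf].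
pose sel (v : window M (L + L) -> bool) (ib : 'I_(tm_extra M).+2 * 'I_4) :=
  has v (@head_wires M L ib.1 ib.2).
have csel : computable ((tm_extra M).+2 * 4 *
    ((6 * L * #|(option (insym + tm_work M) : finType)|).+1)) sel.
  have -> : ((tm_extra M).+2 * 4 = #|(('I_(tm_extra M).+2 * 'I_4)%type : finType)|)%N.
    by rewrite card_prod !card_ord.
  apply: computable_family => ib.
  by refine (computable_le (computable_or _) _); rewrite ltnS size_head_wires.
pose ksel := computable_keep csel.
have c1 := computable_keep (computable_comp (@computable_select_block M L) cf).
have c2 := computable_comp (computable_comp ksel c1) (@computable_restore_block M L).
eexists; first refine (computable_le c2 _).
  have w1 := @card_window M L L0; have w2 := @card_window M (L + L) (ltn_addr _ L0).
  have e1 : ((6 * L * #|(option (insym + tm_work M) : finType)|).+1 <=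
      (6 * #|(option (insym + tm_work M) : finType)|).+1 * L)%N by lia.
  rewrite /block_cost mulnDl.
  move: (4 * 2 ^ 8)%N => q.
  set k := (_ + _ * #|marked_cell M|)%N in w1 w2 *.
  have e2 : (#|window M L| * q <= k * L * q)%N by rewrite leq_mul2r w1 orbT.
  have e3 : (#|window M (L + L)| * q <= k * (L + L) * q)%N by rewrite leq_mul2r w2 orbT.
  have e4 := leq_mul (leqnn ((tm_extra M).+2 * 4)) e1.
  rewrite mulnA in e4.
  have e5 : (k * 3 * q * L = k * L * q + k * (L + L) * q)%N by nia.
  by rewrite e5; lia.
move=> c o hc.
have /choice[b Hb] i : exists b : 'I_4,
    o i + (b.+1 * L)%:Z <= cfg_head c i < o i + (b.+2 * L)%:Z.
  have := hc i.
  have [H|H] := ltP (cfg_head c i) (o i + (2 * L)%:Z).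
    by move=> hi; exists (Ordinal (isT : (0 < 4)%N)) => /=; lia.
  have [H1|H1] := ltP (cfg_head c i) (o i + (3 * L)%:Z).
    by move=> hi; exists (Ordinal (isT : (1 < 4)%N)) => /=; lia.
  have [H2|H2] := ltP (cfg_head c i) (o i + (4 * L)%:Z).
    by move=> hi; exists (Ordinal (isT : (2 < 4)%N)) => /=; lia.
  by move=> hi; exists (Ordinal (isT : (3 < 4)%N)) => /=; lia.
have selE i b' : sel (view c o) (i, b') = (b' == b i).
  rewrite /sel head_wiresP /=; apply/idP/eqP => [H|-> //]; apply/val_inj => /=.
  have := Hb i; case: (ltngtP b' (b i)) => // lt.
    by have : (b'.+2 * L <= (b i).+1 * L)%N; [rewrite leq_mul2r ltnS lt orbT | lia].
  by have : ((b i).+2 * L <= b'.+1 * L)%N; [rewrite leq_mul2r ltnS lt orbT | lia].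
pose o' i := o i + (b i * L)%:Z.
pose D (x : window M (L + L) + 'I_(tm_extra M).+2 * 'I_4) :=
  match x with inl y => view c o y | inr ib => sel (view c o) ib end.
change (restore_block (fun x : _ + window M L =>
  match x with inl y => D y | inr j => f (select_block D) j end) = view (iter L (@tm_step M) c) o).
have Dsel : select_block D = @view M L c o'.
  apply/funext => -[s'|[[i z] a]] //=.
  apply/existsP/idP => [|H].
    move=> [b']; rewrite selE => /andP[/eqP-> ]; rewrite /o' /=.
    by rewrite PoszD addrA.
  by exists (b i); rewrite selE eqxx /=; move: H; rewrite /o' /= PoszD addrA.
rewrite Dsel Hf; last first.
  by move=> i; have := Hb i; rewrite /o'; lia.
apply/funext => -[s'|[[i y] a]] //=.
transitivity (if insub (y - b i * L)%N is Some z then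
         if (b i * L <= y)%N then @view M L (iter L (@tm_step M) c) o' (inr (i, z, a))
         else @view M (L + L) c o (inr (i, y, a))
       else @view M (L + L) c o (inr (i, y, a))).
  apply/existsP/idP => [|H].
    move=> [b']; rewrite selE => /andP[/eqP-> ].
    by case: insub => // z; case: ifP.
  exists (b i); rewrite selE eqxx /=; move: H.
  by case: insub => // z; case: ifP.
have := head_iter c L i.
set c' := iter L _ c => hi.
(* Outside the triple a cell is more than [L] away from the initial head position: its symbol is not
   written, and its mark is false before and after. *)
have old : (y < b i * L)%N || (b i * L + 3 * L <= y)%N ->
    view c o (inr (i, y, a)) = view c' o (inr (i, y, a)).
  move=> out; rewrite /view tape_iter; last by have := Hb i; lia.
  have -> : (o i + (y : nat)%:Z == cfg_head c i) = false.
    by apply/eqP; have := Hb i; lia.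
  have -> // : (o i + (y : nat)%:Z == cfg_head c' i) = false.
  by apply/eqP; have := Hb i; lia.
case: insubP => [z _ Ez|]; last first.
  by rewrite -leqNgt => le; rewrite old //; apply/orP; right; lia.
case: leqP => le; last by rewrite old // le.
have Eo : o' i + (z : nat)%:Z = o i + (y : nat)%:Z by rewrite /o' Ez; lia.
by rewrite /view Eo.
Qed.

(** A head in the middle third [[2L, 4L)] is still in [[L, 5L)] after [L] steps, where the half
    simulation applies again. The recursion s(2L) = 2 s(L) + O(L) has a solution of order L log
    L. *)
Lemma simulates_double (M : tm) (L s : nat) : (0 < L)%N -> simulates M L s ->
  simulates M (L + L) (2 * (s + block_cost M * L)).
Proof.
move=> L0 /(simulates_half L0)[f cf Hf].
exists (fun v => f (f v)); first by rewrite mul2n -addnn; exact: (computable_comp cf cf).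
move=> c o hc; rewrite Hf; last by move=> i; have := hc i; lia.
rewrite Hf ?iterD // => i.
by have := hc i; have := head_iter c L i; lia.
Qed.

Lemma simulates_pow2 (M : tm) :
  exists s, forall j, simulates M (2 ^ j) ((s + block_cost M * j) * 2 ^ j).
Proof.
have [s Hs] := simulates_one M; exists s; elim=> [|j IH].
  by rewrite muln0 addn0 muln1.
have := simulates_double (expn_gt0 2 j) IH.
rewrite addnn -mul2n -expnS mulnDl -addnA.
by rewrite (_ : 2 * _ = (s + block_cost M * j.+1) * 2 ^ j.+1)%N // expnS; lia.
Qed.

(** The constant [a] depends on the machine alone. Tape 0 carries a fixed string [x] of any length,
    which is how a preprocessed description becomes advice; each cell of tape 1 depends on a single
    input wire. *)
Lemma tm_circuit (M : tm) : exists a : nat, forall (I : Type) (j : nat) (x : seq insym)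
    (y : (I -> bool) -> seq insym),
  (forall q, exists i a0 a1, forall v,
     nth None (map Some (y v)) q = if v i then a1 else a0) ->
  computable (a * 2 ^ j * j.+1) (fun v (_ : unit) =>
    tm_out (cfg_state (iter (2 ^ j) (@tm_step M) (tm_init M x (y v)))) == Some true).
Proof.
have [s Hs] := simulates_pow2 M.
set k := (#|tm_state M| + (tm_extra M).+2 * 3 * #|marked_cell M|)%N.
exists (k * (4 * 2 ^ 1) + (s + block_cost M) + 4 * 2 ^ #|tm_state M|)%N.
move=> I j x y Hy; set L := (2 ^ j)%N.
have [f cf Hf] := Hs j.
(* With this origin cell 0, where all heads start, is the first cell of the middle third. *)
pose o := fun i : 'I_(tm_extra M).+2 => - L%:Z.
have /choice[idx /choice[a0 /choice[a1 Hq]]] := Hy.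
have nth_some (w : seq insym) q : nth None [seq Some (inl c) | c <- w] q =
    omap (fun c => inl c : insym + tm_work M) (nth None (map Some w) q).
  have [lt|ge] := ltnP q (size w).
    by rewrite !(nth_map None).
  by rewrite !nth_default ?size_map.
have c1 : computable (#|window M L| * (4 * 2 ^ 1)) (fun v => @view M L (tm_init M x (y v)) o).
  pose h (w : window M L) (_ : unit) : I :=
    match w with inl _ => idx 0%N | inr (i, z, a) => idx (z - L)%N end.
  pose g (w : window M L) (u : unit -> bool) : bool :=
    match w with
    | inl s => tm_start M == s
    | inr (i, z, a) =>
       ((if (L <= z)%N && (i == 1%N :> nat) then
         omap (fun c => inl c : insym + tm_work M) (if u tt then a1 (z - L)%N else a0 (z - L)%N)
        else cfg_tape (tm_init M x [::]) i (o i + (z : nat)%:Z)),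
        o i + (z : nat)%:Z == 0) == a
    end.
  have := computable_local h g; rewrite card_unit => c.
  refine (computable_ext c _) => v [s'|[[i z] a]] //.
  rewrite /g /view /h; congr (_ == _); congr (_, _).
  rewrite /tm_init /= /tape_of_string /o.
  case: leqP => [le|lt].
    have -> : - L%:Z + (z : nat)%:Z = (z - L)%N%:Z by lia.
    case: eqP => [->|]; first by rewrite /= nth_some Hq.
    by case: i => -[|[|m]] ?.
  rewrite /=.
  have -> : - L%:Z + (z : nat)%:Z = Negz (L - z).-1 by rewrite NegzE; lia.
  by [].
have c3 := computable_finite (fun v : tm_state M -> bool =>
  [exists st, v st && (tm_out st == Some true)]).
have cw := computable_wire (fun st : tm_state M => inl st : window M L).
have := computable_comp (computable_comp (computable_comp c1 cf) cw) c3.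
move=> c; refine (computable_le (computable_ext c _) _).
  move=> v _; rewrite Hf; last by move=> i; rewrite /o /=; lia.
  apply/existsP/idP => [|H].
    by move=> [st /andP[/= /eqP <-]].
  by exists (cfg_state (iter L (@tm_step M) (tm_init M x (y v)))); rewrite /= eqxx.
have L0 : (0 < L)%N by rewrite expn_gt0.
have w := @card_window M L L0; rewrite -/k in w.
have e1 : (#|window M L| * (4 * 2 ^ 1) <= k * (4 * 2 ^ 1) * L * j.+1)%N.
  apply: leq_trans (leq_mul w (leqnn _)) _.
  by rewrite mulnAC leq_pmulr.
have e2 : (4 * 2 ^ #|tm_state M| <= 4 * 2 ^ #|tm_state M| * L * j.+1)%N.
  by rewrite -mulnA leq_pmulr // muln_gt0 L0.
have e3 : ((s + block_cost M * j) * L <= (s + block_cost M) * L * j.+1)%N.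
  by rewrite mulnAC leq_mul2r; apply/orP; right; rewrite mulnDl mulnS; lia.
by rewrite !mulnDl; move: e1 e2 e3; rewrite !mulnDl -/L; lia.
Qed.

(** * Taylor expansion of powers *)

(** Negative exponents are included because the induction for the Taylor expansion lowers [p] by one
    each time. *)
Lemma powR_bounded (R : realType) (p : R) : exists2 K : R, 0 <= K &
  forall y : R, `|y - 1| <= 2^-1 -> `|y `^ p| <= K.
Proof.
exists (2 `^ `|p|); first exact: powR_ge0.
move=> y Hy; have y0 : 0 < y by move: Hy; rewrite ler_norml; lra.
rewrite ger0_norm ?powR_ge0 //.
have [p0|p0] := leP 0 p.
  rewrite (ger0_norm p0); apply: ge0_ler_powR; rewrite ?nnegrE //; first exact: ltW.
  by move: Hy; rewrite ler_norml; lra.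
have -> : y `^ p = y^-1 `^ (- p) by rewrite -powR_inv1 ?ltW // -powRrM mulN1r opprK.
rewrite (ltr0_norm p0).
apply: ge0_ler_powR; rewrite ?nnegrE ?invr_ge0 ?oppr_ge0 //; try exact: ltW.
have y2 : 2^-1 <= y by move: Hy; rewrite ler_norml; lra.
by rewrite -[leRHS]invrK lef_pV2 ?posrE ?invr_gt0 ?ltr0n.
Qed.

Lemma antiderivative (R : realType) (q : {poly R}) (m : nat) (c : R) : (size q <= m)%N ->
  exists Q : {poly R}, [/\ (size Q <= m.+1)%N, Q.[0] = c & Q^`() = q].
Proof.
move=> sq; exists (\poly_(i < m.+1) (if i is j.+1 then q`_j / j.+1%:R else c)); split.
- exact: size_poly.
- by rewrite horner_coef0 coef_poly.
apply/polyP => i; rewrite coef_deriv coef_poly ltnS.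
case: ltnP => [_|le]; last by rewrite mul0rn nth_default // (leq_trans sq).
by rewrite -[LHS]mulr_natr divfK // pnatr_eq0.
Qed.

(** If [q] approximates y^(p-1) to order [m] and [Q] is the antiderivative of p q with constant term
    1, then y^p - Q(y-1) vanishes at 1 and has derivative p (y^(p-1) - q(y-1)). The mean value
    theorem gains one factor |y-1|. *)
Lemma taylor_powR (R : realType) (m : nat) (p : R) :
  exists (q : {poly R}) (K : R), [/\ (size q <= m)%N, 0 <= K &
    forall y : R, `|y - 1| <= 2^-1 -> `|y `^ p - q.[y - 1]| <= K * `|y - 1| ^+ m].
Proof.
elim: m p => [|m IH] p.
  have [K K0 HK] := powR_bounded p.
  exists 0, K; split=> // [|y Hy]; first by rewrite size_poly0.
  by rewrite horner0 subr0 expr0 mulr1 HK.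
have [q [K [sq K0 Hq]]] := IH (p - 1).
have [Q [sQ Q0 dQ]] := @antiderivative R (p *: q) m 1 (leq_trans (size_scale_leq _ _) sq).
exists Q, (`|p| * K); split=> // [|y Hy]; first by rewrite mulr_ge0.
pose S := Q \Po ('X - 1%:P).
pose F (z : R) := z `^ p - S.[z].
pose dF (z : R) := p * (z `^ (p - 1) - q.[z - 1]).
have FE z : F z = z `^ p - Q.[z - 1] by rewrite /F /S horner_comp !hornerE.
have derF (z : R) : 0 < z -> is_derive z 1 F (dF z).
  move=> z0; rewrite /dF mulrBr.
  have -> : p * q.[z - 1] = S^`().[z].
    by rewrite /S deriv_comp derivB derivX derivC subr0 mulr1 horner_comp dQ !hornerE.
  have ? := is_derive1_powR p z0.
  have ? : is_derive z 1 (horner S) S^`().[z].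
    exact: is_derive_poly.
  exact: is_deriveB.
have contF (z : R) : 0 < z -> {for z, continuous F}.
  move=> z0; apply/differentiable_continuous/derivable1_diffP.
  by have := derF z z0 => -[].
have F1 : F 1 = 0 by rewrite FE powR1 subrr Q0 subrr.
have bound (z : R) : `|z - 1| <= `|y - 1| -> `|dF z| <= `|p| * K * `|y - 1| ^+ m.
  move=> Hz; rewrite /dF normrM -mulrA ler_wpM2l //.
  apply: le_trans (Hq z (le_trans Hz Hy)) _.
  by rewrite ler_wpM2l // lerXn2r ?nnegrE.
have pos (z : R) : `|z - 1| <= `|y - 1| -> 0 < z.
  by move=> Hz; have := le_trans Hz Hy; rewrite ler_norml; lra.
rewrite -FE exprSr mulrA.
have -> : F y = F y - F 1 by rewrite F1 subr0.
have [y1|y1] := leP 1 y.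
  have n1 : `|y - 1| = y - 1 by rewrite ger0_norm // subr_ge0.
  have sub z : 1 <= z <= y -> `|z - 1| <= `|y - 1|.
    by move=> /andP[h1 h2]; rewrite n1 ger0_norm ?subr_ge0 // lerB.
  have [||c] := @MVT_segment R F dF 1 y y1.
  - by move=> z; rewrite in_itv /= => /andP[h1 h2]; apply/derF/pos/sub; rewrite !ltW.
  - apply: continuous_in_subspaceT => z; rewrite inE /= in_itv /= => h.
    by apply/contF/pos/sub.
  rewrite in_itv /= => /sub /bound Hc ->.
  by rewrite normrM ler_wpM2r.
have n1 : `|y - 1| = 1 - y by rewrite distrC ger0_norm // subr_ge0 ltW.
have sub z : y <= z <= 1 -> `|z - 1| <= `|y - 1|.
  by move=> /andP[h1 h2]; rewrite n1 distrC ger0_norm ?subr_ge0 // lerB.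
have [||c] := @MVT_segment R F dF y 1 (ltW y1).
- by move=> z; rewrite in_itv /= => /andP[h1 h2]; apply/derF/pos/sub; rewrite !ltW.
- apply: continuous_in_subspaceT => z; rewrite inE /= in_itv /= => h.
  by apply/contF/pos/sub.
rewrite in_itv /= => /sub /bound Hc E.
by rewrite distrC E normrM n1 [`|1 - y|]ger0_norm ?subr_ge0 ?(ltW y1) // ler_wpM2r // ?subr_ge0 ?(ltW y1) // -n1.
Qed.

(** * Clause gadgets *)

(** An integer combination of point evaluations. A pair belongs to one row, with target [g.1] when
    the clause is on and [g.2] when it is off, so the total weight is 0 and constants are killed. *)
Definition pairing (R : realType) (G : seq (int * int)) (u : int -> R) : R :=
  \sum_(g <- G) (u g.1 - u g.2).

Definition dilate (m : int) (G : seq (int * int)) := [seq (m * g.1, m * g.2) | g <- G].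

Definition swap_pairs (G : seq (int * int)) := [seq (g.2, g.1) | g <- G].

Definition copies (n : int) (G : seq (int * int)) :=
  flatten (nseq `|n|%N (if 0 <= n then G else swap_pairs G)).

(* The dilation acts on a function homogeneous of degree q as multiplication by 2^q,
   hence this operation kills the functions whose degree satisfies 2^q = a. *)
Definition annihilate (a : nat) (G : seq (int * int)) := dilate 2 G ++ copies (- a%:Z) G.

Definition annihilator (s : seq nat) := foldr annihilate [:: (1, 0)] s.

Lemma pairing_cat (R : realType) G H (u : int -> R) :
  pairing (G ++ H) u = pairing G u + pairing H u.
Proof. by rewrite /pairing big_cat. Qed.

Lemma pairing_dilate (R : realType) m G (u : int -> R) :
  pairing (dilate m G) u = pairing G (fun z => u (m * z)).
Proof. by rewrite /pairing big_map. Qed.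

Lemma pairing_copies (R : realType) n G (u : int -> R) :
  pairing (copies n G) u = n%:~R * pairing G u.
Proof.
have H (a : nat) G' : pairing (flatten (nseq a G')) u = a%:R * pairing G' u.
  elim: a => [|a IH] /=; first by rewrite mul0r /pairing big_nil.
  by rewrite pairing_cat IH -[in RHS]natr1 mulrDl mul1r addrC.
rewrite /copies H; case: (lerP 0 n) => n0.
  by rewrite -{2}(gez0_abs n0).
rewrite -{2}[n]opprK -(ltz0_abs n0) rmorphN mulNr -mulrN /=; congr (_ * _).
by rewrite /pairing big_map -sumrN; apply: eq_bigr => g _; rewrite opprB.
Qed.

Lemma pairingZ (R : realType) G a (u : int -> R) :
  pairing G (fun z => a * u z) = a * pairing G u.
Proof. by rewrite /pairing mulr_sumr; apply: eq_bigr => g _; rewrite mulrBr. Qed.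

Lemma pairingD (R : realType) G (u v : int -> R) :
  pairing G (fun z => u z + v z) = pairing G u + pairing G v.
Proof. by rewrite /pairing -big_split; apply: eq_bigr => g _ /=; rewrite addrACA opprD. Qed.

Lemma pairingN (R : realType) G (u : int -> R) : pairing G (fun z => - u z) = - pairing G u.
Proof. by rewrite /pairing -sumrN; apply: eq_bigr => g _; rewrite opprB opprK addrC. Qed.

Lemma pairing_sum (R : realType) G (I : Type) (r : seq I) (f : I -> int -> R) :
  pairing G (fun z => \sum_(i <- r) f i z) = \sum_(i <- r) pairing G (f i).
Proof.
by rewrite /pairing exchange_big; apply: eq_bigr => g _; rewrite sumrB.
Qed.

Lemma eq_pairing (R : realType) G (u v : int -> R) : u =1 v -> pairing G u = pairing G v.
Proof. by move=> uv; apply: eq_bigr => g _; rewrite !uv. Qed.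

Lemma pairing_annihilator (R : realType) (s : seq nat) (u : int -> R) (l : R) :
  (forall z, u (2 * z) = l * u z) ->
  pairing (annihilator s) u = \prod_(a <- s) (l - a%:R) * (u 1 - u 0).
Proof.
move=> Hu; elim: s => [|a s IH] /=.
  by rewrite /pairing big_nil big_seq1 mul1r.
rewrite big_cons pairing_cat pairing_dilate pairing_copies (eq_pairing _ Hu) pairingZ.
by rewrite rmorphN mulNr -mulrBl IH mulrA.
Qed.

Lemma pairing_annihilator_exp (R : realType) (s : seq nat) (i : nat) :
  pairing (annihilator s) (fun z => z%:~R ^+ i : R) =
  (\prod_(a <- s) (2 ^+ i - a%:Z) * (i != 0%N)%:Z)%:~R.
Proof.
rewrite (@pairing_annihilator _ _ _ (2 ^+ i)); last by move=> z; rewrite intrM exprMn.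
rewrite intrM rmorph_prod; congr (_ * _).
  by apply: eq_bigr => a _; rewrite rmorphB rmorphXn.
by rewrite expr1n expr0n; case: eqP; rewrite /= ?subrr ?subr0.
Qed.

Lemma pairing_bound (R : realType) G (u : int -> R) (Z : int) (e : R) :
  (forall g : int * int, g \in G -> (`|g.1| <= Z) && (`|g.2| <= Z)) ->
  (forall z : int, `|z| <= Z -> `|u z| <= e) -> `|pairing G u| <= (size G)%:R * (2 * e).
Proof.
move=> HG Hu; apply: le_trans (ler_norm_sum _ _ _) _.
have -> : (size G)%:R * (2 * e) = \sum_(g <- G) (2 * e).
  by rewrite big_const_seq count_predT iter_addr_0 mulr_natl.
rewrite big_seq [leRHS]big_seq.
apply: ler_sum => g /HG /andP[h1 h2]; apply: le_trans (ler_normB _ _) _.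
by rewrite mulr2n mulrDl !mul1r lerD ?Hu.
Qed.

Lemma pairs_bounded (G : seq (int * int)) : exists Z : nat,
  forall g : int * int, g \in G -> (`|g.1| <= Z%:Z) && (`|g.2| <= Z%:Z).
Proof.
elim: G => [|[a b] G [Z HZ]]; first by exists 0%N.
exists (Z + `|a| + `|b|)%N => -[x y]; rewrite inE => /predU1P[[-> ->] /=|/HZ /=].
  by apply/andP; split; lia.
by move=> /andP[h1 h2]; apply/andP; split; lia.
Qed.

(* The gadget G with scale c encodes a clause by rows c w - z, where w is the number of
   satisfied literals: switching the targets from the second to the first components
   of G costs about 0 if w > 0, and at least 4 if w = 0. *)
Definition clause_gadget (R : realType) (p : R) (k : nat) : Prop :=
  exists (G : seq (int * int)) (K : nat),
    4 <= pairing G (fun z => `|z%:~R| `^ p) /\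
    forall M : nat, exists c : nat, [/\ (0 < c)%N, (c <= K * M.+1)%N &
      forall w : nat, (0 < w <= k)%N ->
        `|pairing G (fun z => `|(c * w)%:R - z%:~R| `^ p)| <= M.+1%:R^-1].

(** In the binomial expansion of (w - z)^P the annihilator kills every power z^i with 1 <= i <= P
    except z^j, and z^0 disappears because the total weight is 0. The coefficient of z^j is a
    multiple of w^(P-j). *)
Lemma monomial_gadget (R : realType) (P j : nat) : (0 < j <= P)%N ->
  exists (G : seq (int * int)) (t : int), t != 0 /\ forall w : R,
    pairing G (fun z => (w - z%:~R) ^+ P) = t%:~R * w ^+ (P - j).
Proof.
move=> /andP[j0 jP].
pose s := [seq (2 ^ i)%N | i <- iota 1 P & i != j].
exists (annihilator s), ((-1) ^+ j * (\prod_(a <- s) (2 ^+ j - a%:Z)) *+ 'C(P, j)).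
have sP a : a \in s -> exists2 i, (0 < i <= P)%N && (i != j) & a = (2 ^ i)%N.
  move=> /mapP[i]; rewrite mem_filter mem_iota => /andP[ij Hi] ->.
  by exists i => //; rewrite ij andbT; lia.
split.
  rewrite mulrn_eq0 negb_or -lt0n bin_gt0 jP mulf_neq0 //.
    by rewrite expf_neq0 // oppr_eq0 oner_eq0.
  rewrite prodf_seq_neq0; apply/allP => a /sP[i /andP[_ ij] ->] /=.
  rewrite subr_eq0 -natrX natz eqz_nat; apply: contra ij => /eqP/eqP.
  by rewrite eqn_exp2l // eq_sym.
move=> w.
pose F (i : 'I_P.+1) (z : int) : R := ((-1) ^+ i * w ^+ (P - i) *+ 'C(P, i)) * z%:~R ^+ i.
have -> : pairing (annihilator s) (fun z => (w - z%:~R) ^+ P) =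
    pairing (annihilator s) (fun z => \sum_i F i z).
  apply: eq_pairing => z; rewrite exprDn; apply: eq_bigr => i _; rewrite /F.
  by rewrite (exprNn z%:~R) mulrnAl mulrCA mulrA.
rewrite (pairing_sum _ _ F) (bigD1 (Ordinal (leq_ltn_trans jP (ltnSn P)))) //= big1 => [|i ij].
  rewrite addr0 pairingZ pairing_annihilator_exp -lt0n j0 mulr1.
  rewrite rmorphMn rmorphM rmorphXn rmorphN1 /= !mulrnAl; congr (_ *+ _).
  by rewrite mulrAC.
rewrite pairingZ pairing_annihilator_exp.
case: (posnP i) => [->|i0]; first by rewrite mulr0 mulr0.
rewrite (_ : \prod_(a <- s) _ = 0) ?mul0r ?mulr0 //.
apply/eqP; rewrite prodf_seq_eq0; apply/hasP; exists (2 ^ i)%N.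
  apply/mapP; exists (i : nat) => //; rewrite mem_filter mem_iota.
  by rewrite -(inj_eq val_inj) /= in ij; rewrite ij; have := ltn_ord i; lia.
by rewrite /= subr_eq0 -natrX natz.
Qed.

Lemma clause_gadget_even (R : realType) (h : nat) : (1 < h)%N ->
  clause_gadget ((2 * h)%:R : R) 3.
Proof.
move=> h1; set P := (2 * h)%N.
have powE (x : R) : `|x| `^ P%:R = x ^+ P.
  by rewrite powR_mulrn // /P exprM -normrX ger0_norm ?sqr_ge0 // -exprM.
have H j : (j <= 3)%N -> exists (G : seq (int * int)) (t : int), t != 0 /\ forall w : R,
    pairing G (fun z => (w - z%:~R) ^+ P) = t%:~R * w ^+ j.
  move=> j3; have [|G [t [t0 Ht]]] := @monomial_gadget R P (P - j); first by rewrite /P; lia.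
  by exists G, t; split=> // w; rewrite Ht subKn // /P; lia.
have [G0 [t0 [t0n H0]]] := H 0%N isT.
have [G1 [t1 [t1n H1]]] := H 1%N isT.
have [G2 [t2 [t2n H2]]] := H 2%N isT.
have [G3 [t3 [t3n H3]]] := H 3%N isT.
(* The multiplicity of each [Gi] contains one factor [ti] and the squares of the others, so that all
   four monomials get the common factor [N]. It is a square, hence positive whatever the signs of
   the [ti]. *)
pose N := (t0 * t1 * t2 * t3) ^+ 2.
have N1 : 1 <= N by rewrite /N -gtz0_ge1 exprn_even_gt0 //= !mulf_neq0.
pose G := copies (6 * t0 * (t1 * t2 * t3) ^+ 2) G0 ++
  copies (- 11 * t1 * (t0 * t2 * t3) ^+ 2) G1 ++
  copies (6 * t2 * (t0 * t1 * t3) ^+ 2) G2 ++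
  copies (- t3 * (t0 * t1 * t2) ^+ 2) G3.
(* 6 - 11 w + 6 w^2 - w^3 = (1 - w) (2 - w) (3 - w) *)
have GE (w : R) : pairing G (fun z => `|w - z%:~R| `^ P%:R) =
    N%:~R * ((1 - w) * (2 - w) * (3 - w)).
  under eq_pairing => z do rewrite powE.
  rewrite !pairing_cat !pairing_copies H0 H1 H2 H3 /N.
  by rewrite !(intrM, rmorphXn, rmorphN) /=; ring.
exists G, 1%N; split.
  have := GE 0; under eq_pairing => z do rewrite sub0r normrN.
  move=> ->; rewrite !subr0 mul1r.
  have : 1 <= N%:~R :> R by rewrite ler1z.
  by lra.
move=> M; exists 1%N; split=> // w w3; rewrite GE mul1n.
suff -> : ((1 - w%:R) * (2 - w%:R) * (3 - w%:R) : R) = 0.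
  by rewrite mulr0 normr0 invr_ge0 ler0n.
by case: w w3 => [|[|[|[|w]]]] //= _; ring.
Qed.

(** Odd powers of z cancel by symmetry, and the factors 4^j = 2^(2j) with j < m annihilate the even
    ones below z^(2m). What is left of the expansion of X^p |1 - z/X|^p is O(X^(p-2m)), hence
    O(1/X). The expansion is valid since |z/X| <= 1/2 for X > 2Z. *)
Lemma pairing_symmetric_bound (R : realType) (p : R) (m : nat) : 1 <= p -> p + 1 <= (2 * m)%:R ->
  let G := annihilator [seq (4 ^ j)%N | j <- iota 0 m] in
  exists (C : R) (X0 : nat), [/\ 0 <= C, (0 < X0)%N & forall X : R, X0%:R <= X ->
    `|pairing G (fun z => `|X - z%:~R| `^ p + `|X + z%:~R| `^ p)| <= C / X].
Proof.
move=> p1 pm G; have [Z HZ] := pairs_bounded G.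
have [q [K [sq K0 Hq]]] := taylor_powR (2 * m) p.
exists ((size G)%:R * (2 * (2 * K * Z%:R ^+ (2 * m)))), (2 * Z + 1)%N; split.
- by rewrite !mulr_ge0 // ?exprn_ge0.
- by rewrite addn1.
move=> X; rewrite natrD natrM => XZ.
have Z0 : (0 : R) <= Z%:R by [].
have X0 : 0 < X by lra.
have X1 : 1 <= X by lra.
pose F (i : 'I_(2 * m)) (z : int) : R :=
  (X `^ p * q`_i * ((-1) ^+ i + 1) * X ^- i) * z%:~R ^+ i.
pose e z : R := X `^ p * (1 - z%:~R / X) `^ p - X `^ p * q.[- (z%:~R / X)].
have zX (z : int) : `|z| <= Z%:Z -> `|z%:~R / X| <= 2^-1.
  move=> zZ; rewrite normrM normfV (gtr0_norm X0) ler_pdivrMr //.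
  have : `|z%:~R| <= Z%:R :> R by rewrite -intr_norm -[Z%:R]/(Z%:Z%:~R) ler_int.
  by lra.
have split_e (z : int) : `|z| <= Z%:Z -> `|X - z%:~R| `^ p = X `^ p * q.[- (z%:~R / X)] + e z.
  move=> zZ; rewrite /e [in RHS]addrC subrK -powRM ?(ltW X0) //; last first.
    by have := zX z zZ; rewrite ler_norml; lra.
  congr (_ `^ _); rewrite mulrBr mulr1 mulrCA divff ?gt_eqF // mulr1 ger0_norm //.
  have := zX z zZ; rewrite normrM normfV (gtr0_norm X0) ler_pdivrMr // ler_norml; lra.
have polyF (z : int) : X `^ p * q.[- (z%:~R / X)] + X `^ p * q.[z%:~R / X] = \sum_i F i z.
  rewrite !(horner_coef_wide _ sq) -mulrDr -big_split mulr_sumr; apply: eq_bigr => i _ /=.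
  rewrite /F (exprNn (z%:~R / X)) !exprMn exprVn.
  move: (X `^ p) q`_i ((-1) ^+ i) (z%:~R ^+ i) (X ^- i) => x1 x2 x3 x4 x5.
  by ring.
have F0 : pairing G (fun z => \sum_i F i z) = 0.
  rewrite (pairing_sum _ _ F) big1 // => i _; rewrite pairingZ.
  case odd_i: (odd i).
    by rewrite -signr_odd odd_i expr1 addNr !(mulr0, mul0r).
  rewrite /G pairing_annihilator_exp (_ : \prod_(a <- _) _ = 0) ?mul0r ?mulr0 //.
  apply/eqP; rewrite prodf_seq_eq0; apply/hasP; exists (4 ^ i./2)%N.
    by apply: map_f; rewrite mem_iota /=; have := ltn_ord i; lia.
  rewrite /= subr_eq0 -natrX natz; apply/eqP; congr (_%:Z).
  by rewrite -[in LHS](odd_double_half i) odd_i add0n -muln2 mulnC expnM.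
have e_bound (z : int) : `|z| <= Z%:Z -> `|e z| <= X `^ p * (K * (Z%:R / X) ^+ (2 * m)).
  move=> zZ; rewrite /e -mulrBr normrM ger0_norm ?powR_ge0 // ler_wpM2l ?powR_ge0 //.
  have y1 : 1 - z%:~R / X - 1 = - (z%:~R / X) by lra.
  have := Hq (1 - z%:~R / X); rewrite y1 normrN => /(_ (zX z zZ)) /le_trans; apply.
  rewrite ler_wpM2l // lerXn2r ?nnegrE ?divr_ge0 ?(ltW X0) //.
  rewrite normrM normfV (gtr0_norm X0) ler_wpM2r ?invr_ge0 ?(ltW X0) //.
  by rewrite -intr_norm -[Z%:R]/(Z%:Z%:~R) ler_int.
pose E z := `|X - z%:~R| `^ p + `|X + z%:~R| `^ p - \sum_i F i z.
have -> : pairing G (fun z => `|X - z%:~R| `^ p + `|X + z%:~R| `^ p) = pairing G E.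
  rewrite /E (pairingD _ _ (fun z => - \sum_i F i z)).
  by rewrite (pairingN _ (fun z => \sum_i F i z)) F0 oppr0 addr0.
have E_bound (z : int) : `|z| <= Z%:Z -> `|E z| <= 2 * (X `^ p * (K * (Z%:R / X) ^+ (2 * m))).
  move=> zZ; rewrite /E -polyF split_e //.
  have -> : X + z%:~R = X - (- z)%:~R by rewrite rmorphN opprK.
  have nzZ : `|- z| <= Z%:Z by rewrite normrN.
  rewrite split_e // rmorphN mulNr opprK.
  have -> : forall a b c d : R, a + b + (c + d) - (a + c) = b + d by move=> a b c d; ring.
  by apply: le_trans (ler_normD _ _) _; rewrite mulr2n mulrDl !mul1r lerD ?e_bound.
apply: le_trans (pairing_bound HZ E_bound) _.
rewrite -!mulrA ler_wpM2l // ler_wpM2l // ler_wpM2l //.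
rewrite exprMn mulrCA ler_wpM2l // mulrCA ler_wpM2l ?exprn_ge0 //.
rewrite exprVn ler_pdivrMr ?exprn_gt0 // mulrC.
rewrite -powR_mulrn ?(ltW X0) //.
apply: le_trans (ler_powR X1 (_ : p <= (2 * m)%:R - 1)) _; first by lra.
rewrite powRB; first by rewrite powRr1 // ltW.
by rewrite (gt_eqF X0) implybT.
Qed.

(** For w = 0 the function |z|^p is homogeneous of degree p, and the annihilator multiplies it by
    the factors 2^p - 4^j. They are non-zero because p is not of the form 2j. *)
Lemma clause_gadget_noneven (R : realType) (p : R) (k : nat) : 1 <= p ->
  ~ (exists m : int, p = 2 * m%:~R) -> clause_gadget p k.
Proof.
move=> p1 pne.
have [m pm] : exists m : nat, p + 1 <= (2 * m)%:R.
  exists (Num.bound p).+1; have := archi_boundP (le_trans ler01 p1).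
  by rewrite natrM -natr1; set b := (_%:R); lra.
have [C [X0 [C0 X00 HC]]] := pairing_symmetric_bound p1 pm.
set G := annihilator _ in HC.
pose u (z : int) : R := `|z%:~R| `^ p.
have p0 : p != 0 by lra.
have uE : pairing G u != 0.
  rewrite (@pairing_annihilator _ _ u (2 `^ p)); last first.
    by move=> z; rewrite /u intrM normrM powRM // normr_nat.
  rewrite /u normr1 normr0 powR1 powR0 // subr0 mulr1 prodf_seq_neq0.
  apply/allP => a /mapP[j _ ->] /=; rewrite subr_eq0; apply/eqP => E.
  apply: pne; exists j%:Z.
  have E4 : (4 ^ j)%:R = 2 `^ (2 * j)%:R :> R by rewrite powR_mulrn // -natrX expnM.
  have : ln (2 `^ p) = ln (2 `^ (2 * j)%:R : R) by rewrite E E4.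
  rewrite !ln_powR => /mulIf ->; first by rewrite natrM.
  by rewrite gt_eqF // ln_gt0 // ltr1n.
(* Adding the negated pairs produces the symmetric sum of [pairing_symmetric_bound] and doubles the
   value at w = 0. *)
pose G1 := G ++ dilate (-1) G.
have G1E (v : int -> R) : pairing G1 v = pairing G (fun z => v z + v (- z)).
  rewrite pairing_cat pairing_dilate pairingD; congr (_ + _).
  by apply: eq_pairing => z; rewrite mulN1r.
have G1u : pairing G1 u = 2 * pairing G u.
  rewrite G1E -pairingZ; apply: eq_pairing => z.
  by rewrite /u rmorphN normrN mulr2n mulrDl !mul1r.
(* A multiple with the sign of the pairing makes the value at w = 0 positive and at least 4. *)
pose N := Num.bound (4 / `|pairing G1 u|).
pose n : int := if 0 <= pairing G1 u then N%:Z else - N%:Z.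
have nu : `|n%:~R| = N%:R :> R.
  by rewrite /n; case: ifP => _; rewrite ?rmorphN ?normrN normr_nat.
have v0 : 0 < `|pairing G1 u| by rewrite normr_gt0 G1u mulf_neq0 // pnatr_eq0.
pose b := Num.bound (N%:R * C).
exists (copies n G1), (X0 + b)%N; split.
  rewrite pairing_copies -[pairing G1 _]/(pairing G1 u).
  have -> : n%:~R * pairing G1 u = N%:R * `|pairing G1 u|.
    rewrite /n; case: (lerP 0 (pairing G1 u)) => h; rewrite ?(ger0_norm h) //.
    by rewrite rmorphN (ltr0_norm h) mulrN mulNr.
  rewrite -ler_pdivrMr //; apply/ltW/archi_boundP.
  by rewrite divr_ge0 // ltW.
move=> M; exists (X0 + b * M.+1)%N; split.
- by rewrite addn_gt0 X00.
- by rewrite mulnDl leq_add2r leq_pmulr.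
move=> w /andP[w0 _].
rewrite pairing_copies G1E normrM nu.
set c := ((X0 + b * M.+1) * w)%N.
have cX : (X0 + b * M.+1 <= c)%N by rewrite leq_pmulr.
have c0 : (0 < c)%N by apply: leq_trans cX; rewrite addn_gt0 X00.
have -> : pairing G (fun z => `|c%:R - z%:~R| `^ p + `|c%:R - (- z)%:~R| `^ p) =
    pairing G (fun z => `|c%:R - z%:~R| `^ p + `|c%:R + z%:~R| `^ p).
  by apply: eq_pairing => z; rewrite rmorphN opprK.
apply: le_trans (ler_wpM2l (ler0n _ _) (HC c%:R _)) _.
  by rewrite ler_nat; apply: leq_trans cX; rewrite leq_addr.
rewrite mulrA ler_pdivrMr ?ltr0n // [leRHS]mulrC ler_pdivlMr ?ltr0n //.
apply: le_trans (_ : b%:R * M.+1%:R <= _).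
  by rewrite ler_wpM2r //; apply/ltW/archi_boundP; rewrite mulr_ge0.
by rewrite -natrM ler_nat (leq_trans _ cX) // leq_addl.
Qed.

(** * From CVPP algorithms to circuits *)

(** The form of query that [tm_circuit] can load without computing: a fixed length, and each symbol
    chosen by one input bit. *)
Definition bitwise (I : Type) (y : (I -> bool) -> seq insym) : Prop :=
  (exists s, forall v, size (y v) = s) /\
  (forall q, exists i a0 a1, forall v,
     nth None (map Some (y v)) q = if v i then a1 else a0).

Lemma bitwise_if (I : Type) (i : I) (s1 s0 : seq insym) : size s1 = size s0 ->
  bitwise (fun v => if v i then s1 else s0).
Proof.
move=> E; split; first by exists (size s0) => v; case: ifP.
move=> q; exists i, (nth None (map Some s0) q), (nth None (map Some s1) q) => v.
by case: ifP.
Qed.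

Lemma bitwise_const (I : Type) (i : I) (s : seq insym) : bitwise (fun v : I -> bool => s).
Proof.
have [[l Hl] H] := bitwise_if i (erefl (size s)); split; first by exists (size s).
by move=> q; have [i' [a0 [a1 Ha]]] := H q; exists i', a0, a1 => v; rewrite -Ha if_same.
Qed.

Lemma bitwise_cat (I : Type) (y z : (I -> bool) -> seq insym) :
  bitwise y -> bitwise z -> bitwise (fun v => y v ++ z v).
Proof.
move=> [[s Hs] Hy] [[t Ht] Hz]; split; first by exists (s + t)%N => v; rewrite size_cat Hs Ht.
move=> q; have [lt|ge] := ltnP q s.
  have [i [a0 [a1 H]]] := Hy q; exists i, a0, a1 => v.
  by rewrite map_cat nth_cat size_map Hs lt H.
have [i [a0 [a1 H]]] := Hz (q - s)%N; exists i, a0, a1 => v.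
by rewrite map_cat nth_cat size_map Hs ltnNge ge H.
Qed.

(** [B] does not depend on [v], so the description [P d n B] is a constant, and [a] and [e] depend
    on the algorithm only. Instances are required to avoid the gap between the two answers, where
    the machine may say anything. *)
Lemma cvpp_computable (R : realType) (N : forall d, 'cV[R]_d -> R) (gamma : R)
    (tau : nat -> R) : CVPP_algorithm N gamma tau ->
  exists a e : nat, forall (I : Type) (d n : nat) (B : 'M[rat]_(d, n))
    (t : (I -> bool) -> 'cV[rat]_d) (r : rat) (yes : (I -> bool) -> bool) (ell j : nat),
  lattice_basis (map_mx ratr B : 'M[R]_(d, n)) -> 0 < r ->
  (forall v, size (enc_mx B) + size (enc_mx (t v)) + size (enc_rat r) <= ell)%N ->
  bitwise (fun v => enc_mx (t v) ++ enc_rat r) ->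
  (forall v, let D := dist N (lattice (map_mx ratr B)) (map_mx ratr (t v)) in
     if yes v then D <= ratr r else gamma * ratr r < D) ->
  tau n * ell%:R ^+ e <= (2 ^ j)%:R ->
  computable (a * 2 ^ j * j.+1) (fun v (_ : unit) => yes v).
Proof.
move=> [P [Q [e H]]]; have [a Ha] := tm_circuit Q; exists a, e.
move=> I d n B t r yes ell j Bb r0 len [_ yl] Hyes tau_le.
refine (computable_ext (Ha I j (map Some (P d n B)) _ yl) _) => v _.
have [T [b [_ HT Hh H1 H2]]] := H d n B (t v) r Bb r0.
have TJ : (T <= 2 ^ j)%N.
  rewrite -(ler_nat R); apply: le_trans (le_trans HT _) tau_le.
  set l := (_ + _)%N in HT *.
  have l0 : (0 : R) < l%:R ^+ e by rewrite exprn_gt0 // ltr0n /l addn_gt0 orbC.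
  (* Non-negativity of [tau n] comes from the running time that it bounds. *)
  have tau0 : 0 <= tau n.
    by rewrite -(pmulr_lge0 _ l0) (le_trans _ HT).
  by rewrite ler_wpM2l // lerXn2r ?nnegrE // ler_nat len.
rewrite (halted_iter TJ Hh) /=; move: (Hyes v) => /=.
by case: (yes v) => [/H1 ->|/H2 ->].
Qed.

(** * Lattices given by integer rows *)

Definition int_row (n : nat) (I : Type) := (('I_n -> int) * ((I -> bool) -> int))%type.

Definition residual (n : nat) (I : Type) (v : I -> bool) (z : 'I_n -> int)
    (rho : int_row n I) : int := \sum_j rho.1 j * z j - rho.2 v.

Definition row_nth (n : nat) (I : Type) (rows : seq (int_row n I)) (i : nat) :=
  nth (fun=> 0, fun=> 0) rows i.

Definition basis_of_rows (n : nat) (I : Type) (rows : seq (int_row n I)) :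
    'M[rat]_(size rows, n) := \matrix_(i, j) ((row_nth rows i).1 j)%:~R.

Definition target_of_rows (n : nat) (I : Type) (rows : seq (int_row n I)) (v : I -> bool) :
    'cV[rat]_(size rows) := \col_i ((row_nth rows i).2 v)%:~R.

Definition scale_row (n : nat) (I : Type) (a : int) (rho : int_row n I) : int_row n I :=
  (fun j => a * rho.1 j, fun v => a * rho.2 v).

Lemma residual_scale (n : nat) (I : Type) (v : I -> bool) z a (rho : int_row n I) :
  residual v z (scale_row a rho) = a * residual v z rho.
Proof.
rewrite /residual /= mulrBr mulr_sumr; congr (_ - _).
by apply: eq_bigr => j _; rewrite mulrA.
Qed.

Lemma lattice_residual (R : realType) (n : nat) (I : Type) (rows : seq (int_row n I))
    (v : I -> bool) (z : 'cV[int]_n) i :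
  (map_mx ratr (basis_of_rows rows) *m map_mx intr z -
   map_mx ratr (target_of_rows rows v) : 'cV[R]_(size rows)) i 0 =
  (residual v (fun j => z j 0) (row_nth rows i))%:~R.
Proof.
rewrite !mxE rmorphB rmorph_sum /= ratr_int; congr (_ - _).
by apply: eq_bigr => j _; rewrite !mxE ratr_int intrM.
Qed.

Lemma basis_of_rows_free (R : realType) (n : nat) (I : Type) (rows : seq (int_row n I)) (a : int) :
  a != 0 ->
  (forall j, exists2 i, (i < size rows)%N &
     (row_nth rows i).1 = fun j' => if j' == j then a else 0) ->
  lattice_basis (map_mx ratr (basis_of_rows rows) : 'M[R]_(size rows, n)).
Proof.
move=> a0 H; apply: inj_row_free => u Hu; apply/rowP => j; rewrite mxE.
have [i lti Ei] := H j.
have := congr1 (fun w : 'rV[R]_(size rows) => w 0 (Ordinal lti)) Hu.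
rewrite !mxE (bigD1 j) //= big1 => [|j' /negPf nj]; last first.
  by rewrite !mxE Ei nj ratr_int mulr0.
rewrite !mxE Ei eqxx ratr_int addr0 => /eqP; rewrite mulf_eq0 intr_eq0 (negPf a0) orbF.
by move/eqP.
Qed.

Lemma size_enc_int (z : int) : size (enc_rat z%:~R) = (trunc_log 2 `|z| + 5)%N.
Proof.
have sb m : size (bits m) = (trunc_log 2 m).+1 by rewrite size_mkseq.
have E (x : insym) (a b : seq bool) :
    size (x :: map Some a ++ None :: map Some b ++ [:: None]) = (size a + size b + 3)%N.
  by rewrite /= size_cat /= size_cat !size_map /=; lia.
rewrite /enc_rat E !sb numq_int denq_int.
by rewrite (_ : trunc_log 2 1 = 0%N) //=; lia.
Qed.

Lemma size_enc_int_le (z : int) : (size (enc_rat z%:~R) <= `|z| + 6)%N.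
Proof.
rewrite size_enc_int; apply: leq_add => //.
have [->|z0] := posnP `|z|; first by [].
by apply: leq_trans (ltnW (ltn_expl _ (isT : (1 < 2)%N))) _; rewrite trunc_logP.
Qed.

Lemma enc_target_of_rows (n : nat) (I : Type) (rows : seq (int_row n I)) (v : I -> bool) :
  enc_mx (target_of_rows rows v) = flatten [seq enc_rat (rho.2 v)%:~R | rho <- rows].
Proof.
rewrite /enc_mx; congr flatten.
have -> : enum {: 'I_(size rows) * 'I_1} = [seq (i, ord0) | i <- enum 'I_(size rows)].
  rewrite enumT unlock /= /prod_enum /=.
  rewrite -[enum 'I_1]/(enum 'I_1) (_ : enum 'I_1 = [:: ord0]); last first.
    by apply: (inj_map val_inj); rewrite val_enum_ord.
  by elim: (enum 'I_(size rows)) => //= i l ->.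
have -> : [seq enc_rat (rho.2 v)%:~R | rho <- rows] =
    [seq enc_rat ((row_nth rows i).2 v)%:~R | i <- map val (enum 'I_(size rows))].
  by rewrite val_enum_ord -{1}(mkseq_nth (fun=> 0, fun=> 0) rows) /mkseq -map_comp.
rewrite -!map_comp.
by apply: eq_map => i /=; rewrite mxE.
Qed.

Lemma size_enc_mx_le (m n s : nat) (A : 'M[rat]_(m, n)) :
  (forall i j, size (enc_rat (A i j)) <= s)%N -> (size (enc_mx A) <= m * n * s)%N.
Proof.
move=> HA; rewrite /enc_mx size_flatten /shape -map_comp sumnE big_map big_enum /=.
have -> : (m * n * s = \sum_(ij in {: 'I_m * 'I_n}) s)%N.
  by rewrite sum_nat_const card_prod !card_ord.
by apply: leq_sum => ij _; exact: HA.
Qed.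

Lemma size_enc_rows (n : nat) (I : Type) (rows : seq (int_row n I)) (v : I -> bool) (V : nat) :
  (forall i j, `|(row_nth rows i).1 j| <= V)%N ->
  (forall i, `|(row_nth rows i).2 v| <= V)%N ->
  (size (enc_mx (basis_of_rows rows)) + size (enc_mx (target_of_rows rows v)) <=
   size rows * n.+1 * (V + 6))%N.
Proof.
move=> H1 H2; rewrite mulnS mulnDl addnC leq_add //.
  have := @size_enc_mx_le _ _ (V + 6) (target_of_rows rows v); rewrite muln1; apply.
  by move=> i j; rewrite mxE (leq_trans (size_enc_int_le _)) // leq_add2r.
apply: size_enc_mx_le => i j.
by rewrite mxE (leq_trans (size_enc_int_le _)) // leq_add2r.
Qed.

Lemma lpnorm_residual (R : realType) (p : R) (n : nat) (I : Type) (rows : seq (int_row n I))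
    (v : I -> bool) (z : 'cV[int]_n) :
  lpnorm p (map_mx ratr (basis_of_rows rows) *m map_mx intr z -
   map_mx ratr (target_of_rows rows v)) =
  (\sum_(rho <- rows) `|(residual v (fun j => z j 0) rho)%:~R| `^ p) `^ p^-1.
Proof.
rewrite /lpnorm; congr (_ `^ _).
rewrite (big_nth (fun=> 0, fun=> 0)) big_mkord.
by apply: eq_bigr => i _; rewrite lattice_residual.
Qed.

Lemma powR_root_le (R : realType) (p x y : R) : 1 <= p -> 0 <= x -> 0 <= y ->
  (x `^ p^-1 <= y) = (x <= y `^ p).
Proof.
move=> p1 x0 y0; have p0 : 0 < p := lt_le_trans ltr01 p1.
have {1}-> : y = (y `^ p) `^ p^-1 by rewrite -powRrM divff ?gt_eqF // powRr1.
apply/idP/idP => H.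
  rewrite leNgt; apply/negP => lt.
  have := @gt0_ltr_powR R p^-1; rewrite invr_gt0 => /(_ p0 (y `^ p) x).
  by rewrite !nnegrE powR_ge0 => /(_ isT x0 lt); rewrite ltNge H.
by apply: ge0_ler_powR; rewrite ?nnegrE ?powR_ge0 // invr_ge0 ltW.
Qed.

Lemma lp_dist_le (R : realType) (p : R) (n : nat) (I : Type) (rows : seq (int_row n I))
    (v : I -> bool) (z : 'I_n -> int) (r : R) : 1 <= p -> 0 <= r ->
  \sum_(rho <- rows) `|(residual v z rho)%:~R| `^ p <= r `^ p ->
  dist (@lpnorm R p) (lattice (map_mx ratr (basis_of_rows rows)))
    (map_mx ratr (target_of_rows rows v)) <= r.
Proof.
move=> p1 r0 H; pose zc : 'cV[int]_n := \col_j z j.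
apply: le_trans (_ : lpnorm p (map_mx ratr (basis_of_rows rows) *m map_mx intr zc -
   map_mx ratr (target_of_rows rows v)) <= _).
  apply: ge_inf; last by exists (map_mx ratr (basis_of_rows rows) *m map_mx intr zc) => //; exists zc.
  by exists 0 => _ [x _ <-]; exact: powR_ge0.
rewrite lpnorm_residual powR_root_le //; last by apply: sumr_ge0 => *; exact: powR_ge0.
have -> // : (fun j => zc j 0) = z by apply/funext => j; rewrite mxE.
Qed.

(** The distance is an infimum, so a strict inequality needs a margin [Y] uniform in the lattice
    vector. *)
Lemma lp_dist_gt (R : realType) (p : R) (n : nat) (I : Type) (rows : seq (int_row n I))
    (v : I -> bool) (r Y : R) : 1 <= p -> 0 <= r -> r `^ p < Y ->
  (forall z, Y <= \sum_(rho <- rows) `|(residual v z rho)%:~R| `^ p) ->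
  r < dist (@lpnorm R p) (lattice (map_mx ratr (basis_of_rows rows)))
    (map_mx ratr (target_of_rows rows v)).
Proof.
move=> p1 r0 rY H; have Y0 : 0 <= Y := le_trans (powR_ge0 r p) (ltW rY).
have p0 : 0 < p := lt_le_trans ltr01 p1.
apply: (@lt_le_trans _ _ (Y `^ p^-1)).
  by rewrite ltNge powR_root_le // -ltNge.
apply: lb_le_inf.
  by eexists; eexists; first by exists 0.
move=> _ [_ [z _ <-] <-]; rewrite lpnorm_residual.
apply: ge0_ler_powR; rewrite ?nnegrE ?invr_ge0 ?(ltW p0) //.
by apply: sumr_ge0 => *; exact: powR_ge0.
Qed.

Lemma linf_dist_le (R : realType) (n : nat) (I : Type) (rows : seq (int_row n I))
    (v : I -> bool) (z : 'I_n -> int) (r : nat) :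
  (forall i, (i < size rows)%N -> `|residual v z (row_nth rows i)| <= r%:Z) ->
  dist (@linfnorm R) (lattice (map_mx ratr (basis_of_rows rows)))
    (map_mx ratr (target_of_rows rows v)) <= r%:R.
Proof.
move=> H; pose zc : 'cV[int]_n := \col_j z j.
apply: le_trans (_ : linfnorm (map_mx ratr (basis_of_rows rows) *m map_mx intr zc -
   map_mx ratr (target_of_rows rows v)) <= _).
  apply: ge_inf; last by exists (map_mx ratr (basis_of_rows rows) *m map_mx intr zc) => //; exists zc.
  by exists 0 => _ [x _ <-]; exact: bigmax_ge_id.
apply: bigmax_le => // i _; rewrite lattice_residual.
have -> : (fun j => zc j 0) = z by apply/funext => j; rewrite mxE.
by rewrite -intr_norm -[r%:R]/(r%:Z%:~R) ler_int H.
Qed.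

Lemma linf_dist_ge (R : realType) (n : nat) (I : Type) (rows : seq (int_row n I))
    (v : I -> bool) (r : nat) :
  (forall z, exists2 i, (i < size rows)%N & r%:Z <= `|residual v z (row_nth rows i)|) ->
  r%:R <= dist (@linfnorm R) (lattice (map_mx ratr (basis_of_rows rows)))
    (map_mx ratr (target_of_rows rows v)).
Proof.
move=> H; apply: lb_le_inf.
  by eexists; eexists; first by exists 0.
move=> _ [_ [z _ <-] <-].
have [i lti Hi] := H (fun j => z j 0).
apply: le_trans (le_bigmax _ _ (Ordinal lti)) => /=.
by rewrite lattice_residual -intr_norm -[r%:R]/(r%:Z%:~R) ler_int Hi.
Qed.

(** * Polynomial bounds *)

Definition poly_bounded (f : nat -> nat) : Prop :=
  exists a b : nat, forall n, (f n <= a * n.+1 ^ b)%N.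

Lemma poly_bounded_le (f g : nat -> nat) : poly_bounded g ->
  (forall n, f n <= g n)%N -> poly_bounded f.
Proof. by move=> [a [b H]] fg; exists a, b => n; apply: leq_trans (H n). Qed.

Lemma poly_bounded_const (c : nat) : poly_bounded (fun=> c).
Proof. by exists c, 0%N => n; rewrite muln1. Qed.

Lemma poly_bounded_succ : poly_bounded succn.
Proof. by exists 1%N, 1%N => n; rewrite mul1n expn1. Qed.

Lemma poly_bounded_mul (f g : nat -> nat) : poly_bounded f -> poly_bounded g ->
  poly_bounded (fun n => f n * g n)%N.
Proof.
move=> [a [b Hf]] [a' [b' Hg]]; exists (a * a')%N, (b + b')%N => n.
by rewrite expnD mulnACA leq_mul.
Qed.

Lemma poly_bounded_add (f g : nat -> nat) : poly_bounded f -> poly_bounded g ->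
  poly_bounded (fun n => f n + g n)%N.
Proof.
move=> [a [b Hf]] [a' [b' Hg]]; exists (a + a')%N, (b + b')%N => n.
rewrite mulnDl leq_add //; first apply: leq_trans (Hf n) _; last apply: leq_trans (Hg n) _.
  by rewrite leq_mul2l leq_pexp2l ?orbT // leq_addr.
by rewrite leq_mul2l leq_pexp2l ?orbT // leq_addl.
Qed.

Lemma poly_bounded_exp (f : nat -> nat) (c : nat) : poly_bounded f ->
  poly_bounded (fun n => f n ^ c)%N.
Proof.
move=> Hf; elim: c => [|c IH]; first exact: poly_bounded_const.
by apply: poly_bounded_le (poly_bounded_mul Hf IH) _ => n; rewrite expnS.
Qed.

(** A clause is recovered from the list of its literals, padded to [k] optional literals. *)
Lemma card_kclause (n k : nat) : (#|kclause n k| <= (2 * n.+1) ^ k)%N.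
Proof.
pose g (C : kclause n k) : {ffun 'I_k -> option (literal n)} :=
  [ffun i : 'I_k => nth None (map Some (enum (val C))) i].
have sub (C D : kclause n k) : g C = g D -> val C \subset val D.
  move=> E; apply/fintype.subsetP => l lC.
  have lt : (index l (enum (val C)) < size (enum (val C)))%N by rewrite index_mem mem_enum.
  have ltk : (index l (enum (val C)) < k)%N by apply: leq_trans lt _; rewrite -cardE (valP C).
  have := congr1 (fun h : {ffun _ -> _} => h (Ordinal ltk)) E; rewrite !ffunE /=.
  rewrite (nth_map l) // nth_index ?mem_enum //.
  have [lt'|ge] := ltnP (index l (enum (val C))) (size (enum (val D))); last first.
    by rewrite nth_default ?size_map.
  by rewrite (nth_map l) // => -[->]; rewrite -mem_enum mem_nth.
have inj : injective g.
  by move=> C D E; apply/val_inj/eqP; rewrite finset.eqEsubset !sub.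
apply: leq_trans (leq_card g inj) _.
by rewrite card_ffun card_ord card_option card_prod card_ord card_bool; case: k {g sub inj} => [|k] //; rewrite leq_exp2r //; lia.
Qed.

(** * Counting satisfied literals *)

Definition sat_lits (n k : nat) (a : {ffun 'I_n -> bool}) (C : kclause n k) : nat :=
  #|[set l in val C | a l.1 == l.2]%SET|.

Definition lit_coef (n k : nat) (C : kclause n k) (j : 'I_n) : int :=
  ((j, true) \in val C)%:Z - ((j, false) \in val C)%:Z.

Lemma clause_satE (n k : nat) a (C : kclause n k) : clause_sat a C = (0 < sat_lits a C)%N.
Proof.
apply/existsP/card_gt0P => -[l]; rewrite ?inE => H; exists l; rewrite ?inE //.
Qed.

Lemma sat_lits_le (n k : nat) a (C : kclause n k) : (sat_lits a C <= k)%N.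
Proof.
apply: leq_trans (valP C); apply/subset_leq_card/fintype.subsetP => l.
by rewrite inE => /andP[].
Qed.

(** A positive literal counts x_j and a negative one 1 - x_j. The constant term is the number of
    negative literals, which are those satisfied by the all-false assignment. *)
Lemma sum_lit_coef (n k : nat) (a : {ffun 'I_n -> bool}) (C : kclause n k) :
  \sum_j lit_coef C j * (a j : nat)%:Z =
  (sat_lits a C)%:Z - (sat_lits [ffun=> false] C)%:Z.
Proof.
have H (b : {ffun 'I_n -> bool}) : (sat_lits b C)%:Z = \sum_j (((j, true) \in val C)%:Z * (b j : nat)%:Z +
    ((j, false) \in val C)%:Z * (~~ b j : nat)%:Z).
  rewrite /sat_lits -sum1_card big_mkcond -natz natr_sum /=.
  pose F (j : 'I_n) (c : bool) : int := if ((j, c) \in val C) && (b j == c) then 1 else 0.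
  transitivity (\sum_(l : 'I_n * bool) F l.1 l.2).
    by apply: eq_bigr => -[j c] _; rewrite inE /F /=; case: ifP.
  rewrite -(pair_bigA _ F) /F /=.
  apply: eq_bigr => j _; rewrite big_bool /=.
  by case: (_ \in _); case: (_ \in _); case: (b j).
rewrite !H -sumrB; apply: eq_bigr => j _; rewrite ffunE /lit_coef.
by case: (_ \in _); case: (_ \in _); case: (a j).
Qed.

(** * Sign changes of clauses *)

Definition flip_lit (n : nat) (b : {ffun 'I_n -> bool}) (l : literal n) : literal n :=
  (l.1, l.2 (+) b l.1).

Lemma flip_litK (n : nat) (b : {ffun 'I_n -> bool}) : involutive (flip_lit b).
Proof. by move=> [j c]; rewrite /flip_lit /= -addbA addbb addbF. Qed.

Lemma flip_clause_subproof (n k : nat) b (C : kclause n k) :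
  (#|flip_lit b @: val C| <= k)%N.
Proof. by rewrite card_imset ?(valP C) //; exact: inv_inj (flip_litK b). Qed.

Definition flip_clause (n k : nat) b (C : kclause n k) : kclause n k :=
  exist _ (flip_lit b @: val C)%SET (flip_clause_subproof b C).

Lemma flip_clauseK (n k : nat) b : involutive (@flip_clause n k b).
Proof.
move=> C; apply: val_inj; rewrite /= -imset_comp -[RHS]imset_id.
by apply: eq_imset => l /=; rewrite flip_litK.
Qed.

Lemma sat_lits_flip (n k : nat) (a b : {ffun 'I_n -> bool}) (C : kclause n k) :
  sat_lits [ffun j => a j (+) b j] (flip_clause b C) = sat_lits a C.
Proof.
rewrite /sat_lits -[RHS](card_imset _ (inv_inj (flip_litK b))).
suff -> : [set l in val (flip_clause b C) | [ffun j => a j (+) b j] l.1 == l.2]%SET =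
    (flip_lit b @: [set l in val C | a l.1 == l.2])%SET by [].
apply/finset.setP => l; rewrite -(flip_litK b l); move: (flip_lit b l) => {}l.
rewrite (mem_imset _ _ (inv_inj (flip_litK b))) !inE (mem_imset _ _ (inv_inj (flip_litK b))).
rewrite ffunE /flip_lit /=; congr (_ && _).
by case: (a _); case: (b _); case: l.2.
Qed.

(* Every clause occurs with all sign patterns. *)
Lemma sum_sat_lits_const (R : realType) (n k : nat) (a a' : {ffun 'I_n -> bool})
    (f : nat -> R) :
  \sum_(C : kclause n k) f (sat_lits a C) = \sum_(C : kclause n k) f (sat_lits a' C).
Proof.
pose b := [ffun j => a j (+) a' j].
rewrite [RHS](reindex_inj (inv_inj (@flip_clauseK n k b))) /=.
apply: eq_bigr => C _; congr f; rewrite -(sat_lits_flip a b).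
by congr sat_lits; apply/ffunP => j; rewrite !ffunE addbA addbb.
Qed.

(** * Rational approximation of the radius *)

(** The threshold on the cost is a real number while the radius must be rational with a short
    encoding. The lattice is scaled by [lam] so that the interval from lam Y^(1/p) to lam
    (Y+1)^(1/p) is longer than 1 and contains an integer [r]. *)
Lemma radius_exists (R : realType) (p : R) (P : nat) (Y : R) (U : nat) :
  1 <= p -> p <= P%:R -> 1 <= Y -> Y <= U%:R ->
  exists lam r : nat, [/\ (0 < lam <= P * U.+1 + 1)%N, (0 < r <= lam * U + 1)%N,
    lam%:R `^ p * Y <= r%:R `^ p & r%:R `^ p < lam%:R `^ p * (Y + 1)].
Proof.
move=> p1 pP Y1 YU; have p0 : 0 < p := lt_le_trans ltr01 p1.
have Y0 : 0 < Y := lt_le_trans ltr01 Y1.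
have [y yE] : exists y, y = Y `^ p^-1 by eexists.
have [y' yE'] : exists y', y' = (Y + 1) `^ p^-1 by eexists.
have yp : y `^ p = Y by rewrite yE -powRrM mulVf ?gt_eqF // powRr1 // ltW.
have yp' : y' `^ p = Y + 1 by rewrite yE' -powRrM mulVf ?gt_eqF // powRr1 // ltW // addr_gt0.
have y0 : 0 < y by rewrite yE powR_gt0.
have y'0 : 0 < y' by rewrite yE' powR_gt0 // addr_gt0.
have ip0 : 0 < p^-1 by rewrite invr_gt0.
have ip1 : p^-1 <= 1 by rewrite invf_le1.
have yY : y <= Y by rewrite yE; apply: ler1_powR.
have y'1 : 1 <= y'.
  rewrite yE' -[leLHS](powRr0 (Y + 1)); apply: ler_powR; first by lra.
  exact: ltW.
have yy' : y <= y'.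
  rewrite yE yE'; apply: ge0_ler_powR; rewrite ?nnegrE ?(ltW ip0) ?(ltW Y0) ?lerDl //.
  by rewrite addr_ge0 // ltW.
(* With q = y/y', Bernoulli's inequality gives 1 = (Y+1)(1 - q^p) <= (Y+1) P (1 - q), and 1 - q <=
   y' - y because y' >= 1. *)
have gap : 1 <= (Y + 1) * P%:R * (y' - y).
  have [q qE] : exists q, q = y / y' by eexists.
  have q0 : 0 < q by rewrite qE divr_gt0.
  have q1 : q <= 1 by rewrite qE ler_pdivrMr // mul1r.
  have yq : y = y' * q by rewrite qE mulrCA divff ?gt_eqF // mulr1.
  have E : 1 = (Y + 1) * (1 - q `^ p).
    rewrite -yp' mulrBr mulr1 -powRM ?(ltW y'0) ?(ltW q0) // -yq yp yp'; lra.
  have qP : q ^+ P <= q `^ p.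
    by rewrite -powR_mulrn ?(ltW q0) //; apply: ger_powR; rewrite ?q0.
  have bern : 1 - q ^+ P <= P%:R * (1 - q).
    elim: (P) => [|m IH]; first by rewrite expr0 mul0r subrr.
    rewrite exprS -natr1 mulrDl mul1r.
    have : q * (1 - q ^+ m) <= 1 * (1 - q ^+ m).
      rewrite ler_wpM2r // subr_ge0 exprn_ile1 // ltW //.
    by lra.
  rewrite {1}E -mulrA ler_wpM2l //; first by lra.
  apply: le_trans (_ : 1 - q ^+ P <= _); first by lra.
  apply: le_trans bern _; rewrite ler_wpM2l //.
  have : (1 - q) * 1 <= (1 - q) * y' by rewrite ler_wpM2l // subr_ge0.
  by rewrite yq; lra.
have [lam lamE] : exists lam, lam = (P * U.+1 + 1)%N by eexists.
have lam0 : (0 : R) < lam%:R by rewrite ltr0n lamE addn1.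
have lgap : 1 < lam%:R * (y' - y).
  have h : (Y + 1) * P%:R < lam%:R.
    rewrite lamE natrD natrM -natr1; have P0 : (0 : R) <= P%:R by [].
    have : (Y + 1) * P%:R <= (U%:R + 1) * P%:R by rewrite ler_wpM2r // lerD2r.
    by lra.
  have d0 : 0 < y' - y.
    rewrite lt_neqAle subr_ge0 yy' andbT eq_sym; apply/eqP => d0; move: gap.
    by rewrite d0 mulr0 ler10.
  by apply: le_lt_trans gap _; rewrite ltr_pM2r.
pose r := (Num.truncn (lam%:R * y)).+1.
have ly0 : 0 <= lam%:R * y by rewrite mulr_ge0 ?ltW.
have [r1 r2] : lam%:R * y < r%:R /\ r%:R <= lam%:R * y + 1.
  rewrite /r; have /andP[h1 h2] := truncn_itv ly0.
  by split=> //; rewrite -natr1 lerD2r.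
exists lam, r; split.
- by rewrite lamE leqnn andbT addn1.
- rewrite /= -(ler_nat R) natrD natrM; apply: le_trans r2 _.
  by rewrite lerD2r ler_wpM2l ?ler0n // (le_trans yY).
- rewrite -yp -powRM ?(ltW lam0) ?(ltW y0) //; apply: ge0_ler_powR; rewrite ?nnegrE ?(ltW p0) //.
  exact: ltW.
rewrite -yp' -powRM ?(ltW lam0) ?(ltW y'0) //; apply: gt0_ltr_powR; rewrite ?nnegrE //.
  by rewrite mulr_ge0 ?ltW.
apply: le_lt_trans r2 _.
by move: lgap; rewrite mulrBr; lra.
Qed.

(** * Reduction to CVPP in the p-norm *)

Definition sat_count (n k : nat) (v : kclause n k -> bool) (a : {ffun 'I_n -> bool}) : nat :=
  \sum_(C | v C) clause_sat a C.

Definition gain_at_least (n k theta : nat) (v : kclause n k -> bool) : bool :=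
  [exists a : {ffun 'I_n -> bool}, (sat_count v [ffun=> false] + theta <= sat_count v a)%N].

Definition force_row (n : nat) (I : Type) (A : nat) (i : 'I_n) : int_row n I :=
  (fun j => if j == i then (2 * A)%:Z else 0, fun=> A%:Z).

(* The second row does not involve the lattice vector.  It exchanges the two possible targets, so that the
   encoding of both rows together has a length which does not depend on v. *)
Definition gadget_rows (n k c : nat) (C : kclause n k) (g : int * int) :
    seq (int_row n (kclause n k)) :=
  let shift := (c * sat_lits [ffun=> false] C)%:Z in
  [:: (fun j => c%:Z * lit_coef C j, fun v => (if v C then g.1 else g.2) - shift);
      (fun=> 0, fun v => (if v C then g.2 else g.1) - shift)].

(** The initial row adds A^p to every cost, which keeps the threshold on the cost at least 1 even
    for n = 0. *)
Definition lp_rows (n k A c : nat) (G : seq (int * int)) : seq (int_row n (kclause n k)) :=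
  (fun=> 0, fun=> A%:Z) :: [seq force_row _ A i | i <- enum 'I_n] ++
  flatten [seq flatten [seq gadget_rows c C g | g <- G] | C <- enum (kclause n k)].

Definition bitwise_rows (n : nat) (I : Type) (rows : seq (int_row n I)) : Prop :=
  bitwise (fun v => flatten [seq enc_rat (rho.2 v)%:~R | rho <- rows]).

Lemma bitwise_rows_cat (n : nat) (I : Type) (rows rows' : seq (int_row n I)) :
  bitwise_rows rows -> bitwise_rows rows' -> bitwise_rows (rows ++ rows').
Proof.
move=> h h'; have := bitwise_cat h h'; rewrite /bitwise_rows.
by under [in X in _ -> X]eq_fun => v do rewrite map_cat flatten_cat.
Qed.

Lemma bitwise_rows_flatten (n : nat) (I T : Type) (i : I) (l : seq T)
    (f : T -> seq (int_row n I)) :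
  (forall x, bitwise_rows (f x)) -> bitwise_rows (flatten [seq f x | x <- l]).
Proof.
move=> Hf; elim: l => [|x l IH] /=; first exact: (bitwise_const i).
exact: bitwise_rows_cat.
Qed.

Lemma bitwise_lp_rows (n k A c : nat) (G : seq (int * int)) (lam : int) :
  bitwise_rows [seq scale_row lam rho | rho <- lp_rows n k A c G].
Proof.
have C0 : kclause n k.
  by exists finset.set0; rewrite cards0.
have cst (x : int_row n (kclause n k)) u : x.2 = (fun=> u) -> bitwise_rows [:: scale_row lam x].
  by move=> E; rewrite /bitwise_rows /= E; exact: (bitwise_const C0).
rewrite /lp_rows -cat1s map_cat; apply: bitwise_rows_cat; first exact: (@cst (fun=> 0, fun=> A%:Z) A%:Z erefl).
rewrite map_cat; apply: bitwise_rows_cat.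
  rewrite -map_comp -flatten_map1.
  by apply: (bitwise_rows_flatten C0) => i /=; exact: (@cst (force_row _ A i) A%:Z erefl).
rewrite map_flatten -map_comp; apply: (bitwise_rows_flatten C0) => C /=.
rewrite map_flatten -map_comp; apply: (bitwise_rows_flatten C0) => g /=.
rewrite /bitwise_rows /=.
set s := (_ * sat_lits _ C)%:Z.
pose e (x : int) := enc_rat (lam * (x - s))%:~R.
have := @bitwise_if _ C (e g.1 ++ e g.2) (e g.2 ++ e g.1).
rewrite !size_cat addnC => /(_ erefl).
congr bitwise; apply/funext => v; rewrite cats0 /e.
by case: (v C).
Qed.

(** * Cost of a lattice vector *)

Definition row_cost (R : realType) (p : R) (c w : nat) (x : int) : R :=
  `|(c * w)%:R - x%:~R| `^ p.

(** The first gadget row depends on the assignment, but summed over all clauses its cost does not,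
    by [sum_sat_lits_const]; it may be evaluated at the all-false assignment. *)
Definition off_cost (R : realType) (p : R) (c n k : nat) (G : seq (int * int)) : R :=
  \sum_(C : kclause n k) \sum_(g <- G) (row_cost p c (sat_lits [ffun=> false] C) g.2 +
    row_cost p c (sat_lits [ffun=> false] C) g.1).

(** The subtracted term is the auxiliary row: its targets are exchanged in the opposite direction,
    and it always pays as for the all-false assignment. *)
Definition switch_cost (R : realType) (p : R) (c n k : nat) (G : seq (int * int))
    (v : kclause n k -> bool) (a : {ffun 'I_n -> bool}) : R :=
  \sum_(C | v C) (pairing G (row_cost p c (sat_lits a C)) -
    pairing G (row_cost p c (sat_lits [ffun=> false] C))).

Lemma lp_rows_cost (R : realType) (p : R) (n k A c : nat) (G : seq (int * int)) v z :
  \sum_(rho <- lp_rows n k A c G) `|(residual v z rho)%:~R| `^ p =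
  A%:R `^ p + \sum_i `|(2 * A%:Z * z i - A%:Z)%:~R| `^ p +
  \sum_(C : kclause n k) \sum_(g <- G) \sum_(rho <- gadget_rows c C g)
    `|(residual v z rho)%:~R| `^ p :> R.
Proof.
rewrite big_cons big_cat big_map big_enum /= addrA; congr (_ + _ + _).
- by rewrite /residual big1 /= ?sub0r ?rmorphN ?normrN ?normr_nat // => j _; rewrite mul0r.
- apply: eq_bigr => i _; congr (`| _%:~R | `^ _); rewrite /residual /= (bigD1 i) //= eqxx.
  by rewrite big1 ?addr0 ?PoszM // => j /negPf ->; rewrite mul0r.
rewrite big_flatten big_map big_enum; apply: eq_bigr => C _.
by rewrite big_flatten big_map.
Qed.

Lemma binary_cost (R : realType) (p : R) (n k A c : nat) (G : seq (int * int)) v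
    (a : {ffun 'I_n -> bool}) :
  \sum_(rho <- lp_rows n k A c G) `|(residual v (fun i => (a i : nat)%:Z) rho)%:~R| `^ p =
  n.+1%:R * A%:R `^ p + off_cost p c n k G + switch_cost p c G v a :> R.
Proof.
rewrite lp_rows_cost -[RHS]addrA; congr (_ + _).
  rewrite (eq_bigr (fun=> A%:R `^ p)) => [|i _].
    by rewrite sumr_const card_ord -natr1 mulrDl mul1r addrC mulr_natl.
  by case: (a i); rewrite ?mulr0 ?mulr1 ?sub0r; congr (_ `^ _);
     rewrite ?rmorphN ?normrN ?normr_nat // (_ : _ - _ = A%:Z) ?normr_nat //; lia.
pose f0 w : R := \sum_(g <- G) row_cost p c w g.2.
have -> : off_cost p c n k G = \sum_(C : kclause n k) f0 (sat_lits a C) +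
    \sum_(C : kclause n k) \sum_(g <- G) row_cost p c (sat_lits [ffun=> false] C) g.1.
  rewrite /off_cost (sum_sat_lits_const _ a [ffun=> false] f0) -big_split; apply: eq_bigr => C _.
  by rewrite /f0 -big_split.
rewrite /switch_cost [X in _ = _ + X]big_mkcond -!big_split; apply: eq_bigr => C _ /=.
have main (x : int) : `|(\sum_j c%:Z * lit_coef C j * (a j : nat)%:Z -
    (x - (c * sat_lits [ffun=> false] C)%:Z))%:~R| `^ p = row_cost p c (sat_lits a C) x :> R.
  rewrite /row_cost (eq_bigr (fun j => c%:Z * (lit_coef C j * (a j : nat)%:Z))); last first.
    by move=> j _; rewrite mulrA.
  rewrite -mulr_sumr sum_lit_coef; congr (`| _ | `^ _).
  rewrite (_ : _ - _ = (c * sat_lits a C)%:Z - x); first by rewrite rmorphB.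
  by rewrite !PoszM; ring.
have zero (x : int) : `|(\sum_j 0 * (a j : nat)%:Z -
    (x - (c * sat_lits [ffun=> false] C)%:Z))%:~R| `^ p =
    row_cost p c (sat_lits [ffun=> false] C) x :> R.
  rewrite /row_cost big1 => [|j _]; last by rewrite mul0r.
  by rewrite sub0r opprB rmorphB.
rewrite /f0 /pairing -!big_split -sumrB.
case vC: (v C); last first.
  rewrite addr0; apply: eq_bigr => g _.
  by rewrite big_cons big_seq1 /residual /= vC main zero.
rewrite -big_split; apply: eq_bigr => g _ /=.
by rewrite big_cons big_seq1 /residual /= vC main zero; ring.
Qed.

(** An integer other than 0 and 1 has |2z - 1| >= 3, so its row pays at least (3A)^p >= 3 A^p, while
    every row pays at least A^p. *)
Lemma nonbinary_cost (R : realType) (p : R) (n k A c : nat) (G : seq (int * int)) v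
    (z : 'I_n -> int) (i : 'I_n) : 1 <= p -> z i != 0 -> z i != 1 ->
  n.+1%:R * A%:R `^ p + 2 * A%:R `^ p <=
  \sum_(rho <- lp_rows n k A c G) `|(residual v z rho)%:~R| `^ p :> R.
Proof.
move=> p1 z0 z1; have p0 : 0 <= p := le_trans ler01 p1.
rewrite lp_rows_cost.
apply: (@le_trans _ _ (A%:R `^ p + \sum_j `|(2 * A%:Z * z j - A%:Z)%:~R| `^ p)); last first.
  rewrite lerDl; do 3![apply: sumr_ge0 => ? _]; exact: powR_ge0.
rewrite -natr1 mulrDl mul1r (addrC (_ * _)) -addrA lerD2l.
have -> : n%:R * A%:R `^ p = \sum_(j < n) A%:R `^ p :> R.
  by rewrite sumr_const card_ord mulr_natl.
rewrite (bigD1 i) //= [leRHS](bigD1 i) //= addrAC lerD //.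
  apply: le_trans (_ : (3 * A%:R) `^ p <= _).
    rewrite powRM //; have : 3 <= 3 `^ p :> R by apply: le1r_powR => //; lra.
    have : 0 <= A%:R `^ p :> R := powR_ge0 _ _.
    by nra.
  apply: ge0_ler_powR; rewrite ?nnegrE // ?mulr_ge0 //.
  rewrite -intr_norm -[3 * _]/(3%:R * _) -natrM -[_%:R]/(_%:Z%:~R) ler_int.
  nia.
apply: ler_sum => j _; apply: ge0_ler_powR; rewrite ?nnegrE //.
rewrite -intr_norm -[_%:R]/(_%:Z%:~R) ler_int.
have -> : 2 * A%:Z * z j - A%:Z = A%:Z * (2 * z j - 1) by ring.
rewrite normrM ger0_norm // ler_peMr //; lia.
Qed.

(** Each of the at most M clauses that are on brings two errors of at most 1/(2M+1), so the total
    error is below 1. *)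
Lemma switch_cost_approx (R : realType) (p : R) (c n k : nat) (G : seq (int * int))
    (v : kclause n k -> bool) (a : {ffun 'I_n -> bool}) :
  (forall w, (0 < w <= k)%N ->
     `|pairing G (row_cost p c w)| <= (2 * #|kclause n k|).+1%:R^-1) ->
  `|switch_cost p c G v a - pairing G (fun z => `|z%:~R| `^ p) *
     ((sat_count v [ffun=> false])%:R - (sat_count v a)%:R)| <= 1.
Proof.
move=> Hw; set M := #|kclause n k| in Hw; set g := pairing G _.
pose e w : R := pairing G (row_cost p c w) - g * (w == 0%N)%:R.
have e_le w : (w <= k)%N -> `|e w| <= (2 * M).+1%:R^-1.
  rewrite /e; case: (posnP w) => [->|w0] wk; last first.
    by rewrite mulr0 subr0 Hw // w0 wk.
  rewrite mulr1 (_ : pairing G _ = g) ?subrr ?normr0 ?invr_ge0 //.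
  by apply: eq_pairing => z; rewrite /row_cost muln0 sub0r normrN.
have -> : switch_cost p c G v a - g *
     ((sat_count v [ffun=> false])%:R - (sat_count v a)%:R) =
    \sum_(C | v C) (e (sat_lits a C) - e (sat_lits [ffun=> false] C)).
  rewrite /switch_cost /sat_count !natr_sum -sumrB mulr_sumr -sumrB.
  apply: eq_bigr => C _; rewrite /e !clause_satE.
  by case: (posnP (sat_lits a C)) => [->|h]; case: (posnP (sat_lits _ C)) => [->|h'];
    rewrite ?eqxx ?h ?h' ?gtn_eqF //=; ring.
apply: le_trans (ler_norm_sum _ _ _) _.
apply: (@le_trans _ _ (\sum_(C : kclause n k) 2 * (2 * M).+1%:R^-1)).
  rewrite big_mkcond; apply: ler_sum => C _; case: ifP => _; last by rewrite mulr_ge0.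
  apply: le_trans (ler_normB _ _) _.
  by rewrite mulr2n mulrDl !mul1r lerD ?e_le ?sat_lits_le.
rewrite sumr_const -/M -[leLHS]mulr_natr mulrAC ler_pdivrMr ?ltr0n // mul1r -natrM ler_nat.
by rewrite leqnSn.
Qed.

Lemma row_cost_le (R : realType) (p : R) (P c k w Z : nat) (x : int) :
  1 <= p -> p <= P%:R -> (w <= k)%N -> `|x| <= Z%:Z ->
  row_cost p c w x <= ((c * k + Z).+1 ^ P)%:R.
Proof.
move=> p1 pP wk xZ; have p0 : 0 <= p := le_trans ler01 p1.
have xR : `|x%:~R| <= Z%:R :> R by rewrite -intr_norm -[Z%:R]/(Z%:Z%:~R) ler_int.
have h : `|(c * w)%:R - x%:~R| <= (c * k + Z).+1%:R :> R.
  apply: le_trans (ler_normB _ _) _; rewrite normr_nat.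
  rewrite -natr1 natrD; have : (c * w)%:R <= (c * k)%:R :> R by rewrite ler_nat leq_mul2l wk orbT.
  by lra.
apply: (@le_trans _ _ ((c * k + Z).+1%:R `^ p)).
  by apply: ge0_ler_powR; rewrite ?nnegrE.
rewrite natrX -powR_mulrn //; apply: ler_powR => //.
by rewrite ler1n.
Qed.

Lemma off_cost_le (R : realType) (p : R) (P c n k Z : nat) (G : seq (int * int)) :
  1 <= p -> p <= P%:R -> (forall g : int * int, g \in G -> (`|g.1| <= Z%:Z) && (`|g.2| <= Z%:Z)) ->
  off_cost p c n k G <= (#|kclause n k| * (size G * (2 * (c * k + Z).+1 ^ P)))%:R.
Proof.
move=> p1 pP GZ; rewrite natrM -sum1_card natr_sum mulr_suml /off_cost.
apply: ler_sum => C _; rewrite mul1r natrM.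
have -> : (size G)%:R * (2 * (c * k + Z).+1 ^ P)%:R =
    \sum_(g <- G) (2 * (c * k + Z).+1 ^ P)%:R :> R.
  by rewrite big_const_seq count_predT iter_addr_0 mulr_natl.
rewrite big_seq [leRHS]big_seq; apply: ler_sum => g /GZ /andP[g1 g2].
by rewrite mul2n -addnn natrD lerD ?row_cost_le ?sat_lits_le.
Qed.

(** * Number of rows and size of their entries *)

Lemma all_flatten (T : Type) (a : pred T) (ss : seq (seq T)) :
  all a (flatten ss) = all (all a) ss.
Proof. by elim: ss => //= s ss IH; rewrite all_cat IH. Qed.

Lemma size_flatten_const (S T : Type) (l : seq S) (f : S -> seq T) (m : nat) :
  (forall x, size (f x) = m) -> size (flatten [seq f x | x <- l]) = (size l * m)%N.
Proof. by move=> Hf; elim: l => //= x l IH; rewrite size_cat Hf IH mulSn. Qed.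

Lemma size_lp_rows (n k A c : nat) (G : seq (int * int)) :
  size (lp_rows n k A c G) = (n.+1 + 2 * (#|kclause n k| * size G))%N.
Proof.
rewrite /= size_cat size_map size_enum_ord addSn; congr (_ + _).+1.
rewrite (size_flatten_const _ (m := (size G * 2)%N)); first by rewrite -cardE mulnA mulnC.
by move=> C; apply: size_flatten_const.
Qed.

Lemma lp_rows_force_lt (n k A c : nat) (G : seq (int * int)) (lam : int) (i : 'I_n) :
  (i.+1 < size [seq scale_row lam rho | rho <- lp_rows n k A c G])%N.
Proof. by rewrite size_map size_lp_rows; have := ltn_ord i; lia. Qed.

Lemma lp_rows_force (n k A c : nat) (G : seq (int * int)) (lam : int) (i : 'I_n) d :
  nth d [seq scale_row lam rho | rho <- lp_rows n k A c G] i.+1 =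
  scale_row lam (force_row _ A i).
Proof.
rewrite /lp_rows /= map_cat nth_cat 2!size_map size_enum_ord ltn_ord -map_comp.
by rewrite (nth_map i) ?size_enum_ord // nth_ord_enum.
Qed.

Lemma lp_rows_bounded (n k A c Z : nat) (G : seq (int * int)) (lam : int) v (i : nat) :
  (forall g : int * int, g \in G -> (`|g.1| <= Z%:Z) && (`|g.2| <= Z%:Z)) ->
  let rho := row_nth [seq scale_row lam rho | rho <- lp_rows n k A c G] i in
  [forall j, `|rho.1 j| <= `|lam| * (2 * A + (c * k.+1 + Z).+1)]%N &&
  (`|rho.2 v| <= `|lam| * (2 * A + (c * k.+1 + Z).+1))%N.
Proof.
move=> GZ; set B := (2 * A + _)%N.
pose ok (rho : int_row n (kclause n k)) := [forall j, `|rho.1 j| <= B]%N && (`|rho.2 v| <= B)%N.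
have scale_ok rho : ok rho -> [forall j, `|(scale_row lam rho).1 j| <= `|lam| * B]%N &&
    (`|(scale_row lam rho).2 v| <= `|lam| * B)%N.
  move=> /andP[/forallP h1 h2]; rewrite /= !abszM leq_mul // andbT.
  by apply/forallP => j; rewrite abszM leq_mul.
have all_ok : all ok (lp_rows n k A c G).
  rewrite /= all_cat; apply/and3P; split.
  - by apply/andP; split; [apply/forallP | rewrite /B /=; lia].
  - rewrite all_map; apply/allP => i' _ /=; apply/andP; split=> /=; last by rewrite /B; lia.
    by apply/forallP => j /=; case: eqP => _; rewrite /B; lia.
  rewrite all_flatten all_map; apply/allP => C _ /=.
  rewrite all_flatten all_map; apply/allP => -[x y] /GZ /= /andP[h1 h2].
  have le1 w : (w <= k -> c * w <= c * k.+1)%N by move=> h; rewrite leq_mul2l leqW ?orbT.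
  have := le1 _ (sat_lits_le [ffun=> false] C); move: (c * sat_lits _ _)%N => m hm.
  apply/and3P; split=> //; apply/andP; split=> /=.
  - apply/forallP => j; rewrite abszM /lit_coef /B.
    have c1 : (c * `|((j, true) \in val C)%:Z - ((j, false) \in val C)%:Z|%N <= c * 1)%N.
      by rewrite leq_mul2l; case: (_ \in _); case: (_ \in _); rewrite ?orbT.
    by apply: leq_trans c1 _; rewrite muln1 mulnS; lia.
  - by case: (v C); rewrite /B; lia.
  - by apply/forallP.
  - by case: (v C); rewrite /B; lia.
rewrite /row_nth; have [lt|ge] := ltnP i (size (lp_rows n k A c G)).
  rewrite (nth_map (fun=> 0, fun=> 0)) //; apply: scale_ok.
  by have /all_nthP -> := all_ok.
by rewrite nth_default ?size_map //=; apply/andP; split; first apply/forallP.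
Qed.

Lemma binary_or_not (n : nat) (z : 'I_n -> int) :
  (exists a : {ffun 'I_n -> bool}, z = fun i => (a i : nat)%:Z) \/
  exists i, (z i != 0) && (z i != 1).
Proof.
have [|nb] := pselect (exists i, (z i != 0) && (z i != 1)); [by right | left].
exists [ffun i => z i == 1]; apply/funext => i; rewrite ffunE.
apply: contrapT => Hz; apply: nb; exists i.
by apply/andP; split; apply/eqP => E; apply: Hz; rewrite E.
Qed.

Lemma gain_computable (R : realType) (p : R) (k : nat) (tau : nat -> R) :
  1 <= p -> clause_gadget p k -> CVPP_algorithm (@lpnorm R p) 1 tau ->
  exists (a e : nat) (ell : nat -> nat), poly_bounded ell /\
    forall n theta j : nat, (theta <= #|kclause n k|)%N ->
      tau n * (ell n)%:R ^+ e <= (2 ^ j)%:R ->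
      computable (a * 2 ^ j * j.+1)
        (fun (v : kclause n k -> bool) (_ : unit) => gain_at_least theta v).
Proof.
move=> p1 [G [K [g4 HG]]] /cvpp_computable[a [e Hae]].
have p0 : 0 <= p := le_trans ler01 p1.
have [Z GZ] := pairs_bounded G.
pose P := Num.bound p; have pP : p <= P%:R by apply/ltW/archi_boundP.
have P0 : (0 < P)%N by rewrite -(ltr_nat R) (lt_le_trans ltr01 (le_trans p1 pP)).
set g := pairing G _ in g4.
pose Mb n := ((2 * n.+1) ^ k)%N.
pose V n := (K * (2 * Mb n).+1 * k.+1 + Z).+1.
(* [A n] exceeds the cost of the gadgets plus every possible gain, so a vector that is not binary is
   too far away. *)
pose A n := (Mb n * (size G * (2 * V n ^ P)) + (Mb n).+1 * (size G * (2 * V n ^ P)) + 2)%N.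
pose U n := (n.+1 * A n ^ P + A n)%N.
pose Lb n := (P * (U n).+1 + 1)%N.
pose ell n := ((n.+1 + 2 * (Mb n * size G)) * n.+1 * (Lb n * (2 * A n + V n) + 6) +
  (Lb n * U n + 1 + 6))%N.
have Mb_poly : poly_bounded Mb.
  exact: poly_bounded_exp (poly_bounded_mul (poly_bounded_const 2) poly_bounded_succ).
have add := poly_bounded_add; have mul := poly_bounded_mul; have cst := poly_bounded_const.
have W_poly f c : poly_bounded f -> poly_bounded (fun n => f n + c)%N.
  by move=> Hf; exact: (add _ _ Hf (cst c)).
have C_poly f c : poly_bounded f -> poly_bounded (fun n => c * f n)%N.
  by move=> Hf; exact: (mul _ _ (cst c) Hf).
have V_poly : poly_bounded V.
  have H := W_poly _ Z.+1 (C_poly _ k.+1 (C_poly _ K (W_poly _ 1%N (C_poly _ 2%N Mb_poly)))).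
  by apply: poly_bounded_le H _ => n; rewrite /V addn1 addnS mulnC.
have A_poly : poly_bounded A.
  have W := C_poly _ (size G) (C_poly _ 2%N (poly_bounded_exp P V_poly)).
  have H := W_poly _ 2%N (add _ _ (mul _ _ Mb_poly W) (mul _ _ (W_poly _ 1%N Mb_poly) W)).
  by apply: poly_bounded_le H _ => n; rewrite addn1.
have U_poly : poly_bounded U.
  exact: (add _ _ (mul _ _ poly_bounded_succ (poly_bounded_exp P A_poly)) A_poly).
have L_poly : poly_bounded Lb.
  have H := W_poly _ 1%N (C_poly _ P (W_poly _ 1%N U_poly)).
  by apply: poly_bounded_le H _ => n; rewrite /Lb !addn1.
exists a, e, ell; split.
  have H1 := add _ _ poly_bounded_succ (C_poly _ 2%N (mul _ _ Mb_poly (cst (size G)))).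
  have H2 := W_poly _ 6%N (mul _ _ L_poly (add _ _ (C_poly _ 2%N A_poly) V_poly)).
  have H3 := W_poly _ 6%N (W_poly _ 1%N (mul _ _ L_poly U_poly)).
  exact: (add _ _ (mul _ _ (mul _ _ H1 poly_bounded_succ) H2) H3).
move=> n theta j thM tau_le.
set M := #|kclause n k| in thM.
have MMb : (M <= Mb n)%N := card_kclause n k.
have [c [c0 cK Hc]] := HG (2 * M)%N.
have cV1 : ((c * k.+1 + Z).+1 <= V n)%N.
  rewrite /V ltnS leq_add2r leq_mul2r; apply/orP; right.
  by apply: leq_trans cK _; rewrite leq_mul2l ltnS leq_mul2l MMb !orbT.
have cV : ((c * k + Z).+1 <= V n)%N.
  by apply: leq_trans cV1; rewrite ltnS leq_add2r leq_mul2l leqnSn orbT.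
pose H0 : R := off_cost p c n k G.
have H00 : 0 <= H0 by do 2![apply: sumr_ge0 => ? _]; rewrite addr_ge0 ?powR_ge0.
have g_le : g <= (size G * (2 * V n ^ P))%:R.
  apply: le_trans (ler_norm _) _.
  have := @pairing_bound R G (fun z => `|z%:~R| `^ p) Z (V n ^ P)%:R GZ.
  rewrite natrM natrM; apply => z zZ; rewrite ger0_norm ?powR_ge0 //.
  have := @row_cost_le R p P c k 0 Z z p1 pP isT zZ.
  rewrite /row_cost muln0 sub0r normrN => /le_trans; apply.
  by rewrite ler_nat leq_exp2r.
have H0_le : H0 <= (Mb n * (size G * (2 * V n ^ P)))%:R.
  apply: le_trans (@off_cost_le R p P c n k Z G p1 pP GZ) _; rewrite ler_nat leq_mul //.
  by rewrite leq_mul2l leq_mul2l leq_exp2r // cV !orbT.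
have gth : g * theta%:R + g <= ((Mb n).+1 * (size G * (2 * V n ^ P)))%:R.
  rewrite -{2}[g]mulr1 -mulrDr natr1 mulnC natrM ler_pM //; first by lra.
  by rewrite ler_nat ltnS (leq_trans thM).
have A_ge : H0 + (g * theta%:R + g) + 2 <= (A n)%:R by rewrite /A natrD natrD lerD // lerD.
have g0 : 0 <= g * theta%:R by rewrite mulr_ge0 //; lra.
have A1 : 1 <= (A n)%:R :> R by lra.
pose Ap : R := (A n)%:R `^ p.
have Ap_ge : (A n)%:R <= Ap by apply: le1r_powR.
have Ap_le : Ap <= (A n ^ P)%:R by rewrite natrX -powR_mulrn //; apply: ler_powR.
have nAp : Ap <= n.+1%:R * Ap by rewrite ler_peMl ?powR_ge0 // ler1n.
(* With error 1, a gain of [theta] costs at most [Y]. A smaller gain costs at least [Y + g - 2],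
   which is above [Y + 1] since [g >= 4]; the radius falls in between. *)
pose Y : R := n.+1%:R * Ap + H0 - g * theta%:R + 1.
have Y1 : 1 <= Y by rewrite /Y; lra.
have YU : Y <= (U n)%:R.
  rewrite /Y /U natrD natrM.
  have : n.+1%:R * Ap <= n.+1%:R * (A n ^ P)%:R by rewrite ler_wpM2l.
  by lra.
have [lam [r [/andP[lam0 lamL] /andP[r0 rL] Hr1 Hr2]]] := radius_exists p1 pP Y1 YU.
pose rows := [seq scale_row lam%:Z rho | rho <- lp_rows n k (A n) c G].
have cost_scale v z : \sum_(rho <- rows) `|(residual v z rho)%:~R| `^ p =
    lam%:R `^ p * \sum_(rho <- lp_rows n k (A n) c G) `|(residual v z rho)%:~R| `^ p :> R.
  rewrite big_map mulr_sumr; apply: eq_bigr => rho _.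
  by rewrite residual_scale intrM normrM normr_nat powRM.
refine (@Hae _ _ n (basis_of_rows rows) (target_of_rows rows) r%:R _ (ell n) j _ _ _ _ _ tau_le).
- apply: (@basis_of_rows_free _ _ _ _ (lam%:Z * (2 * A n)%:Z)).
    by rewrite mulf_neq0 // -lt0n // muln_gt0 /= -(ltr_nat R) (lt_le_trans ltr01).
  move=> i; exists i.+1; first exact: lp_rows_force_lt.
  by rewrite /row_nth lp_rows_force; apply/funext => j' /=; case: eqP; rewrite ?mulr0.
- by rewrite ltr0n.
- move=> v; rewrite leq_add //; last first.
    by apply: leq_trans (size_enc_int_le r%:Z) _; rewrite leq_add2r (leq_trans rL) // leq_add2r leq_mul2r lamL orbT.
  have big i := @lp_rows_bounded n k (A n) c Z G lam%:Z v i GZ.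
  apply: leq_trans (size_enc_rows _ _ (V := lam * (2 * A n + (c * k.+1 + Z).+1))) _.
  + by move=> i i'; have /andP[/forallP] := big i.
  + by move=> i; have /andP[] := big i.
  rewrite leq_mul //.
    rewrite leq_mul2r size_map size_lp_rows; apply/orP; right.
    by rewrite leq_add2l leq_mul2l leq_mul2r MMb orbT.
  by rewrite leq_add2r leq_mul // leq_add2l.
- have C0 : kclause n k by exists finset.set0; rewrite cards0.
  apply: bitwise_cat (bitwise_const C0 _).
  have := @bitwise_lp_rows n k (A n) c G lam%:Z; rewrite /bitwise_rows -/rows.
  by congr bitwise; apply/funext => v; rewrite enc_target_of_rows.
move=> v /=; rewrite mul1r ratr_nat.
have switch a' := switch_cost_approx v a' Hc.
case: ifP => [/existsP[x Hx]|/negbT/existsPn Hno].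
  apply: (@lp_dist_le R p n _ rows v (fun i => (x i : nat)%:Z) r%:R p1) => //.
  apply: le_trans Hr1; rewrite cost_scale ler_wpM2l ?powR_ge0 // binary_cost /Y.
  have /ler_normlP[_] := switch x; rewrite -/g.
  have : (sat_count v [ffun=> false])%:R + theta%:R <= (sat_count v x)%:R :> R.
    by rewrite -natrD ler_nat.
  move: (sat_count v [ffun=> false])%:R (sat_count v x)%:R => s0 s1 hs.
  have : g * (s0 + theta%:R) <= g * s1 by rewrite ler_wpM2l //; lra.
  by rewrite -/Ap -/H0; lra.
apply: (@lp_dist_gt R p n _ rows v r%:R _ p1 (ler0n _ _) Hr2) => z; rewrite cost_scale ler_wpM2l ?powR_ge0 //.
have [[x Ex]|[i /andP[zi0 zi1]]] := binary_or_not z.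
  rewrite Ex binary_cost /Y.
  have /ler_normlP[+ _] := switch x; rewrite -/g.
  have : (sat_count v x)%:R + 1 <= (sat_count v [ffun=> false])%:R + theta%:R :> R.
    by rewrite natr1 -natrD ler_nat ltnNge Hno.
  move: (sat_count v [ffun=> false])%:R (sat_count v x)%:R => s0 s1 hs.
  have : g * (s1 + 1) <= g * (s0 + theta%:R) by rewrite ler_wpM2l //; lra.
  by rewrite -/Ap -/H0; lra.
apply: le_trans (@nonbinary_cost R p n k (A n) c G v z i p1 zi0 zi1).
by rewrite /Y -/Ap; lra.
Qed.

(** * Reduction to CVPP in the maximum norm *)

Definition all_sat (n k : nat) (v : kclause n k -> bool) : bool :=
  [exists a : {ffun 'I_n -> bool}, [forall C, v C ==> clause_sat a C]].

(* The factor 3 keeps all targets between two consecutive powers of 2, so that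
   their encodings have the same length. *)
Definition inf_radius (k : nat) : nat := 3 * 2 ^ k.+1.

(** The residual is w - r for a clause that is off and w - (r + 1) for one that is on. As 0 <= w <=
    k < r, its absolute value exceeds r only if the clause is on and w = 0. *)
Definition inf_row (n k : nat) (C : kclause n k) : int_row n (kclause n k) :=
  (lit_coef C, fun v : kclause n k -> bool => (inf_radius k + v C)%:Z - (sat_lits [ffun=> false] C)%:Z).

Definition inf_rows (n k : nat) : seq (int_row n (kclause n k)) :=
  [seq force_row _ (inf_radius k) i | i <- enum 'I_n] ++
  [seq inf_row C | C <- enum (kclause n k)].

Lemma inf_radius_bounds (k m : nat) : (m <= k)%N ->
  (2 ^ k.+2 <= inf_radius k - m)%N && (inf_radius k - m < 2 ^ k.+3 - 1)%N.
Proof.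
move=> mk; rewrite /inf_radius !expnS.
have : (k < 2 ^ k)%N by exact: ltn_expl.
by lia.
Qed.

Lemma bitwise_inf_rows (n k : nat) : bitwise_rows (inf_rows n k).
Proof.
have C0 : kclause n k by exists finset.set0; rewrite cards0.
apply: bitwise_rows_cat; rewrite -flatten_map1; apply: (bitwise_rows_flatten C0) => x.
  by rewrite /bitwise_rows /=; exact: (bitwise_const C0).
rewrite /bitwise_rows /=; set m := sat_lits _ _.
pose e (b : bool) := enc_rat ((inf_radius k + b)%:Z - m%:Z)%:~R.
have h b : size (e b) = (k.+2 + 5)%N.
  rewrite size_enc_int; congr (_ + _)%N; apply: trunc_log_eq => //.
  have := inf_radius_bounds (sat_lits_le [ffun=> false] x); rewrite -/m.
  by case: b; lia.
have := @bitwise_if _ x (e true) (e false); rewrite !h => /(_ erefl).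
by congr bitwise; apply/funext => v; rewrite cats0 /e; case: (v x).
Qed.

Lemma size_inf_rows (n k : nat) : size (inf_rows n k) = (n + #|kclause n k|)%N.
Proof.
by rewrite size_cat (size_map (force_row _ _)) (size_map (@inf_row n k)) -!cardE card_ord.
Qed.

Lemma inf_rows_force (n k : nat) (i : 'I_n) :
  row_nth (inf_rows n k) i = force_row _ (inf_radius k) i.
Proof.
rewrite /row_nth nth_cat size_map size_enum_ord ltn_ord.
by rewrite (nth_map i) ?size_enum_ord // nth_ord_enum.
Qed.

Lemma inf_rows_clause (n k : nat) (C : kclause n k) :
  row_nth (inf_rows n k) (n + enum_rank C) = inf_row C.
Proof.
rewrite /row_nth nth_cat size_map size_enum_ord ltnNge leq_addr /= addKn.
by rewrite (nth_map C) ?nth_enum_rank // -cardE ltn_ord.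
Qed.

Lemma inf_rows_bounded (n k : nat) v (i : nat) :
  let rho := row_nth (inf_rows n k) i in
  [forall j, `|rho.1 j| <= 2 * inf_radius k]%N && (`|rho.2 v| <= 2 * inf_radius k)%N.
Proof.
have r1 : (1 < inf_radius k)%N.
  by rewrite /inf_radius expnS; have : (0 < 2 ^ k)%N by [rewrite expn_gt0]; lia.
have [lt|ge] := ltnP i (size (inf_rows n k)); last first.
  by rewrite /row_nth nth_default //=; apply/andP; split; first apply/forallP.
rewrite size_inf_rows in lt.
have [lti|gei] := ltnP i n.
  rewrite -[i]/(nat_of_ord (Ordinal lti)) inf_rows_force /=.
  by apply/andP; split; [apply/forallP => j; case: eqP => _|]; lia.
have lt' : (i - n < #|kclause n k|)%N by lia.
have -> : i = (n + enum_rank (enum_val (Ordinal lt')))%N by rewrite enum_valK /=; lia.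
move: (enum_val _) => C; rewrite inf_rows_clause /=.
have := inf_radius_bounds (sat_lits_le [ffun=> false] C).
move: (sat_lits _ _) => m hm; apply/andP; split; last by case: (v C); lia.
by apply/forallP => j; rewrite /lit_coef; case: (_ \in _); case: (_ \in _); lia.
Qed.

Lemma inf_row_residual (n k : nat) (v : kclause n k -> bool) (a : {ffun 'I_n -> bool}) (C : kclause n k) :
  residual v (fun j => (a j : nat)%:Z) (inf_row C) =
  (sat_lits a C)%:Z - (inf_radius k + v C)%:Z.
Proof. by rewrite /residual /= sum_lit_coef; ring. Qed.

Lemma force_row_residual (n : nat) (I : Type) (v : I -> bool) (A : nat) z (i : 'I_n) :
  residual v z (force_row I A i) = A%:Z * (2 * z i - 1).
Proof.
rewrite /residual /= (bigD1 i) //= eqxx big1 => [|j /negPf ->]; last by rewrite mul0r.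
by rewrite PoszM; ring.
Qed.

(** Residuals are integers, so an unsatisfiable instance has distance at least r + 1, a binary
    vector failing at a clause and any other at a forcing row. The factor 1 + 1/(2r) puts the bound
    at r + 1/2. *)
Lemma all_sat_computable (R : realType) (k : nat) (tau : nat -> R) :
  CVPP_algorithm (@linfnorm R) (1 + (2 * inf_radius k)%:R^-1) tau ->
  exists (a e : nat) (ell : nat -> nat), poly_bounded ell /\
    forall n j : nat, tau n * (ell n)%:R ^+ e <= (2 ^ j)%:R ->
      computable (a * 2 ^ j * j.+1)
        (fun (v : kclause n k -> bool) (_ : unit) => all_sat v).
Proof.
move=> /cvpp_computable[a [e Hae]].
set r := inf_radius k in Hae *.
have r1 : (1 < r)%N.
  by rewrite /r /inf_radius expnS; have : (0 < 2 ^ k)%N by [rewrite expn_gt0]; lia.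
pose Mb n := ((2 * n.+1) ^ k)%N.
pose ell n := ((n.+1 + Mb n) * n.+1 * (2 * r + 6) + (r + 6))%N.
have cst := poly_bounded_const; have succ := poly_bounded_succ.
exists a, e, ell; split.
  have Mb_poly := poly_bounded_exp k (poly_bounded_mul (cst 2%N) succ).
  have H := poly_bounded_mul (poly_bounded_mul (poly_bounded_add succ Mb_poly) succ)
    (cst (2 * r + 6)%N).
  exact: (poly_bounded_add H (cst _)).
move=> n j tau_le; pose rows := inf_rows n k.
refine (@Hae _ _ n (basis_of_rows rows) (target_of_rows rows) r%:R _ (ell n) j _ _ _ _ _ tau_le).
- apply: (@basis_of_rows_free _ _ _ _ (2 * r)%:Z); first by lia.
  move=> i; exists (i : nat); first by rewrite size_inf_rows ltn_addr.
  by rewrite inf_rows_force.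
- by rewrite ltr0n; lia.
- move=> v; rewrite leq_add //; last exact: (size_enc_int_le r%:Z).
  have big i := @inf_rows_bounded n k v i.
  apply: leq_trans (size_enc_rows (V := 2 * r) _ _) _.
  + by move=> i i'; have /andP[/forallP] := big i.
  + by move=> i; have /andP[] := big i.
  rewrite leq_mul2r leq_mul2r size_inf_rows leq_add ?orbT //.
  exact: card_kclause.
- have C0 : kclause n k by exists finset.set0; rewrite cards0.
  apply: bitwise_cat (bitwise_const C0 _).
  have := @bitwise_inf_rows n k; rewrite /bitwise_rows -/rows.
  by congr bitwise; apply/funext => v; rewrite enc_target_of_rows.
move=> v /=; rewrite ratr_nat.
case: ifP => [/existsP[x /forallP Hx]|/negbT/existsPn Hno] /=.
  apply: (@linf_dist_le R n _ rows v (fun i => (x i : nat)%:Z) r) => i.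
  rewrite size_inf_rows => lt.
  have [lti|gei] := ltnP i n.
    rewrite -[i]/(nat_of_ord (Ordinal lti)) inf_rows_force force_row_residual -/r.
    by case: (x _); lia.
  have lt' : (i - n < #|kclause n k|)%N by lia.
  have -> : i = (n + enum_rank (enum_val (Ordinal lt')))%N by rewrite enum_valK /=; lia.
  move: (enum_val _) => C; rewrite inf_rows_clause inf_row_residual -/r.
  have := Hx C; rewrite clause_satE; have := sat_lits_le x C.
  have := inf_radius_bounds (leqnn k); rewrite -/r.
  by case: (v C) => /=; lia.
apply: (@lt_le_trans _ _ r.+1%:R).
  rewrite mulrDl mul1r -natr1 ltrD2l natrM invfM mulfVK ?pnatr_eq0; last by lia.
  by rewrite invf_lt1 // ltr1n.
apply: linf_dist_ge => z.
have [[x ->]|[i /andP[zi0 zi1]]] := binary_or_not z.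
  have /forallPn[C] := Hno x; rewrite negb_imply clause_satE => /andP[vC].
  rewrite lt0n negbK => /eqP sC.
  exists (n + enum_rank C)%N; first by rewrite size_inf_rows ltn_add2l.
  by rewrite inf_rows_clause inf_row_residual sC vC -/r; lia.
exists (i : nat); first by rewrite size_inf_rows ltn_addr.
rewrite inf_rows_force force_row_residual normrM -/r.
have : 3 <= `|2 * z i - 1| by lia.
by nia.
Qed.

(** * Circuits for satisfiability *)

(** The count is kept in unary. Output [j] depends on the new item and on outputs [j] and [j - 1]
    for the tail, three wires in all, hence 32 = 4 * 2^3 gates. *)
Lemma computable_count (I : Type) (l : seq I) (N : nat) :
  computable ((size l).+1 * (N * 32)) (fun v (j : 'I_N) => count v l == j).
Proof.
elim: l => [|i l IH].
  have := computable_local (fun (_ : 'I_N) (x : void) => match x return I with end)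
    (fun j _ => 0%N == j).
  rewrite card_void card_ord => c; refine (computable_le (computable_ext c _) _) => //.
  by rewrite mul1n leq_mul2l orbT.
pose h (j : 'I_N) (x : option bool) : I + 'I_N :=
  match x with
  | None => inl i
  | Some true => inr j
  | Some false => inr (Ordinal (leq_ltn_trans (leq_pred j) (ltn_ord j)))
  end.
pose g (j : 'I_N) (u : option bool -> bool) :=
  if u None then (0 < j)%N && u (Some false) else u (Some true).
have := computable_comp (computable_keep IH) (computable_local h g).
rewrite card_option card_bool card_ord => c.
refine (computable_le (computable_ext c _) _).
  move=> v [j ltj] /=; rewrite /g /h /=; case: (v i) => //=.
  by case: j ltj => //= j ltj; rewrite add1n eqSS.
by rewrite mulSn addnC.
Qed.

Lemma computable_count_eq (I : Type) (l : seq I) (c : nat) :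
  computable ((size l).+1 * (c.+1 * 32)) (fun v (_ : unit) => count v l == c).
Proof.
have cw := computable_wire (fun _ : unit => @ord_max c).
by have := computable_comp (computable_count l c.+1) cw; rewrite addn0.
Qed.

Lemma sat_count_count (n k : nat) (v : kclause n k -> bool) a :
  sat_count v a = count v [seq C <- enum (kclause n k) | clause_sat a C].
Proof.
rewrite count_filter -sum1_count big_enum_cond big_mkcond /sat_count [LHS]big_mkcond /=.
by apply: eq_bigr => C _; case: (v C); case: (clause_sat a C).
Qed.

(** No assignment can gain more than the clauses falsified by the all-false assignment, and gaining
    all of them means satisfying everything. This threshold varies with the formula, so a circuit
    has to try every value. *)
Lemma all_sat_gain (n k : nat) (v : kclause n k -> bool) :
  all_sat v = gain_at_least
    (count v [seq C <- enum (kclause n k) | ~~ clause_sat [ffun=> false] C]) v.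
Proof.
set u := count _ _.
have tot a : sat_count v a = (\sum_(C | v C) 1)%N <-> forall C, v C ==> clause_sat a C.
  split=> [E C|H]; last first.
    by apply: eq_bigr => C vC; have := H C; rewrite vC => /= ->.
  apply/implyP => vC; apply: contraT => nsat.
  have : (sat_count v a < \sum_(C | v C) 1)%N.
    rewrite /sat_count (bigD1 C) //= [ltnRHS](bigD1 C) //= (negPf nsat) add0n add1n ltnS.
    by apply: leq_sum => D _; case: clause_sat.
  by rewrite E ltnn.
have le a : (sat_count v a <= \sum_(C | v C) 1)%N.
  by apply: leq_sum => C _; case: clause_sat.
have uE : (sat_count v [ffun=> false] + u = \sum_(C | v C) 1)%N.
  have -> : u = (\sum_(C | v C) ~~ clause_sat [ffun=> false] C)%N.
    rewrite /u count_filter -sum1_count big_enum_cond big_mkcond [RHS]big_mkcond /=.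
    by apply: eq_bigr => C _; case: (v C); case: (clause_sat _ C).
  by rewrite /sat_count -big_split; apply: eq_bigr => C _ /=; case: clause_sat.
rewrite /all_sat /gain_at_least uE; apply: eq_existsb => a.
by apply/forallP/idP => [/tot ->//|H]; apply/tot/eqP; rewrite eqn_leq le H.
Qed.

Lemma max_satisfiableE (n k : nat) (F : kcnf n k) W :
  max_satisfiable F W = [exists a, W <= sat_count (fun C => C \in F) a]%N.
Proof.
apply: eq_existsb => a; congr (_ <= _)%N; rewrite -sum1_card /sat_count.
rewrite big_mkcond [RHS]big_mkcond /=; apply: eq_bigr => C _.
by rewrite inE; case: (C \in F); case: clause_sat.
Qed.

Lemma size_enc_kcnf (n k : nat) (F : kcnf n k) : size (enc_kcnf F) = #|kclause n k|.
Proof. by rewrite size_map -cardE. Qed.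

Lemma nth_enc_kcnf (n k : nat) (F : kcnf n k) (C : kclause n k) :
  nth false (enc_kcnf F) (enum_rank C) = (C \in F).
Proof. by rewrite (nth_map C) ?nth_enum_rank // -cardE ltn_ord. Qed.

Lemma bits_width_inj (w m m' : nat) : (m < 2 ^ w)%N -> (m' < 2 ^ w)%N ->
  (forall i, (i < w)%N -> odd (m %/ 2 ^ i) = odd (m' %/ 2 ^ i)) -> m = m'.
Proof.
elim: w m m' => [|w IH] m m'; first by rewrite expn0; case: m m' => [|?] [|?].
move=> hm hm' H.
have E : (m %/ 2 = m' %/ 2)%N.
  apply: IH; rewrite ?ltn_divLR // ?[(2 ^ w * 2)%N]mulnC -?expnS // => i iw.
  by rewrite -!divnMA -expnS H.
have := H 0%N isT; rewrite expn0 !divn1 => Eo.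
by rewrite (divn_eq m 2) (divn_eq m' 2) E !modn2 Eo.
Qed.

Definition maxsat_correct (k n : nat) (C : circuit) : Prop :=
  forall (F : kcnf n k) (W : nat), (W <= #|kclause n k|)%N ->
    circuit_eval C (enc_kcnf F ++ bits_width (threshold_width n k) W) = max_satisfiable F W.

Definition sat_correct (k n : nat) (C : circuit) : Prop :=
  forall F : kcnf n k, circuit_eval C (enc_kcnf F) = satisfiable F.

(** The time budget is rounded up to a power 2^j because the simulation proceeds by doubling;
    [j + 1] is its logarithmic overhead and [q] a polynomial one. *)
Definition fast_circuits (R : realType) (tau : nat -> R) (P : nat -> circuit -> Prop) : Prop :=
  exists (e : nat) (q ell : nat -> nat), [/\ poly_bounded q, poly_bounded ell &
    forall n j : nat, tau n * (ell n)%:R ^+ e <= (2 ^ j)%:R ->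
      exists2 C : circuit, P n C & (size C <= q n * (2 ^ j * j.+1))%N].

Lemma maxsat_fast (R : realType) (p : R) (k : nat) (tau : nat -> R) :
  1 <= p -> clause_gadget p k -> CVPP_algorithm (@lpnorm R p) 1 tau ->
  fast_circuits tau (maxsat_correct k).
Proof.
move=> p1 gad /(gain_computable p1 gad)[a [e [ell [ell_poly H]]]].
pose Mb n := ((2 * n.+1) ^ k).+1.
pose q n := (Mb n * Mb n * (a + (Mb n * (Mb n * 32) + (Mb n * 4 + 10))) + 2)%N.
have Mb_poly : poly_bounded Mb.
  have H1 := poly_bounded_exp k (poly_bounded_mul (poly_bounded_const 2) poly_bounded_succ).
  by apply: poly_bounded_le (poly_bounded_add H1 (poly_bounded_const 1)) _ => n; rewrite addn1.
have cst := poly_bounded_const; have mul := poly_bounded_mul; have add := poly_bounded_add.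
exists e, q, ell; split=> //.
  have H1 := mul _ _ Mb_poly (mul _ _ Mb_poly (cst 32%N)).
  have H2 := add _ _ (mul _ _ Mb_poly (cst 4%N)) (cst 10%N).
  exact: (add _ _ (mul _ _ (mul _ _ Mb_poly Mb_poly) (add _ _ (cst a) (add _ _ H1 H2))) (cst 2%N)).
move=> n j tau_le.
set M := #|kclause n k|; have MMb : (M < Mb n)%N := card_kclause n k.
set w := threshold_width n k.
have wM : (w <= M.+1)%N.
  rewrite /w /threshold_width -/M ltnS; case: (posnP M) => [->//|M0].
  by apply: leq_trans (ltnW (ltn_expl _ (isT : (1 < 2)%N))) _; rewrite trunc_logP.
have M2w : (M < 2 ^ w)%N by rewrite /w /threshold_width trunc_log_ltn.
pose inC (v : 'I_(M + w) -> bool) (C : kclause n k) := v (lshift w (enum_rank C)).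
pose l0 := [seq C <- enum (kclause n k) | clause_sat [ffun=> false] C].
(* [s] and [W] are guesses for the number of clauses satisfied by the all-false assignment and for
   the threshold read from the input. Only the right pair passes both comparisons, and its query
   circuit then decides. *)
pose test (sW : nat * nat) (v : 'I_(M + w) -> bool) : bool :=
  (count (inC v) l0 == sW.1) &&
  (all (fun i : 'I_w => v (rshift M i) == odd (sW.2 %/ 2 ^ i)) (enum 'I_w) &&
   ((sW.2 <= sW.1)%N || gain_at_least (sW.2 - sW.1) (inC v))).
pose X := (2 ^ j * j.+1)%N.
have X0 : (0 < X)%N by rewrite muln_gt0 expn_gt0.
pose pairs := [seq (s, W) | s <- iota 0 M.+1, W <- iota 0 M.+1].
have ctest (sW : nat * nat) : sW \in pairs ->
    computable (M.+1 * (M.+1 * 32) + ((w * 3).+1 + ((a * X) .+2)).+1).+1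
    (fun v (_ : unit) => test sW v).
  case/allpairsP => -[s W] [sM WM ->].
  rewrite !mem_iota !add0n /= in sM WM.
  have cin := computable_wire (fun C : kclause n k => lshift w (enum_rank C)).
  have c1 := computable_comp cin (computable_count_eq l0 s).
  have c2 := computable_all (enum 'I_w) (fun i : 'I_w =>
    computable_op eqb (computable_wire (fun _ : unit => rshift M i))
     (@computable_const _ (odd (W %/ 2 ^ i)))).
  have th : (W - s <= M)%N by lia.
  have c3 := computable_op orb (@computable_const 'I_(M + w) (W <= s)%N)
    (computable_comp cin (H n (W - s)%N j th tau_le)).
  have := computable_op andb c1 (computable_op andb c2 c3).
  move=> c; refine (computable_le c _).
  rewrite !add0n -cardE card_ord -/X ltnS leq_add //.
    rewrite leq_mul // ?ltnS ?leq_mul2r ?ltnS ?sM ?orbT //.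
    by rewrite size_filter (leq_trans (count_size _ _)) // -cardE.
  by rewrite !mulnA; lia.
have call : computable (size pairs * (M.+1 * (M.+1 * 32) + ((w * 3).+1 + ((a * X) .+2)).+1).+2).+1
    (fun v (_ : unit) => has (fun sW => (sW \in pairs) && test sW v) pairs).
  apply: computable_has => sW; case: (boolP (sW \in pairs)) => [/ctest//|_] /=.
  by refine (computable_le (@computable_const _ false) _).
have [C sC HC] := computable_circuit call.
exists C.
  move=> F W WM; set inp := enc_kcnf F ++ _.
  have s_inp : size inp = (M + w)%N by rewrite size_cat size_enc_kcnf size_mkseq.
  rewrite HC // max_satisfiableE; set v := fun i : 'I_(M + w) => _.
  have vF : inC v = fun C => C \in F.
    apply/funext => D; rewrite /inC /v /inp nth_cat size_enc_kcnf /= ltn_ord.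
    exact: nth_enc_kcnf.
  have vW (i : 'I_w) : v (rshift M i) = odd (W %/ 2 ^ i).
    by rewrite /v /inp nth_cat size_enc_kcnf /= ltnNge leq_addr /= addKn nth_mkseq.
  set vf := fun C => C \in F in vF *.
  pose s0 := sat_count vf [ffun=> false].
  have s0M : (s0 <= M)%N.
    rewrite /s0 sat_count_count (leq_trans (count_size _ _)) // size_filter.
    by rewrite (leq_trans (count_size _ _)) // -cardE.
  have testE s W' : (W' <= M)%N -> test (s, W') v = (s0 == s) && ((W == W') &&
     ((W' <= s)%N || gain_at_least (W' - s) vf)).
    move=> W'M; rewrite /test /= vF -sat_count_count -/s0; congr (_ && (_ && _)).
    apply/allP/eqP => [E|<- i _]; last by rewrite vW.
    apply: (@bits_width_inj w); rewrite ?(leq_ltn_trans _ M2w) // => i iw.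
    have := E (Ordinal iw) (mem_enum _ _); rewrite vW => /eqP //.
  have gainE : (W <= s0)%N || gain_at_least (W - s0) vf = [exists a, W <= sat_count vf a]%N.
    have [le|lt] := leqP W s0; first by apply/esym/existsP; exists [ffun=> false].
    by rewrite /= /gain_at_least -/s0; apply: eq_existsb => x; rewrite subnKC // ltnW.
  rewrite -gainE; apply/hasP/idP => [|H1].
    move=> [[s W'] _ /andP[/allpairsP[[s' W''] [_ hW [-> E]]]]].
    rewrite testE; last by rewrite E; move: hW; rewrite mem_iota /=; lia.
    by case/and3P => /eqP <- /eqP <-.
  have inp0 : (s0, W) \in pairs by apply: allpairs_f; rewrite mem_iota; lia.
  by exists (s0, W) => //; rewrite inp0 testE //= !eqxx.
apply: leq_trans sC _; rewrite -/X size_allpairs !size_iota.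
have hM : (M.+1 * M.+1 <= Mb n * Mb n)%N by rewrite leq_mul.
have h1 : ((M.+1 * (M.+1 * 32) + ((w * 3).+1 + ((a * X) .+2)).+1).+2 <=
    (a + (Mb n * (Mb n * 32) + (Mb n * 4 + 10))) * X)%N.
  have h32 : (M.+1 * (M.+1 * 32) <= Mb n * (Mb n * 32))%N by rewrite !leq_mul.
  have := leq_pmulr (Mb n * (Mb n * 32) + (Mb n * 4 + 10)) X0.
  by rewrite mulnDl; lia.
have := leq_mul hM h1; rewrite /q mulnDl -mulnA.
have : (2 <= 2 * X)%N by lia.
by lia.
Qed.

Lemma sat_fast (R : realType) (p : R) (k : nat) (tau : nat -> R) :
  1 <= p -> clause_gadget p k -> CVPP_algorithm (@lpnorm R p) 1 tau ->
  fast_circuits tau (sat_correct k).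
Proof.
move=> p1 gad /(gain_computable p1 gad)[a [e [ell [ell_poly H]]]].
pose Mb n := ((2 * n.+1) ^ k).+1.
pose q n := (Mb n * (a + (Mb n * (Mb n * 32) + 10)) + 2)%N.
have cst := poly_bounded_const; have mul := poly_bounded_mul; have add := poly_bounded_add.
have Mb_poly : poly_bounded Mb.
  have H1 := poly_bounded_exp k (mul _ _ (cst 2%N) poly_bounded_succ).
  by apply: poly_bounded_le (add _ _ H1 (cst 1%N)) _ => n; rewrite addn1.
exists e, q, ell; split=> //.
  have H1 := mul _ _ Mb_poly (mul _ _ Mb_poly (cst 32%N)).
  exact: (add _ _ (mul _ _ Mb_poly (add _ _ (cst a) (add _ _ H1 (cst 10%N)))) (cst 2%N)).
move=> n j tau_le.
set M := #|kclause n k|; have MMb : (M < Mb n)%N := card_kclause n k.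
pose inC (v : 'I_M -> bool) (C : kclause n k) := v (enum_rank C).
pose l1 := [seq C <- enum (kclause n k) | ~~ clause_sat [ffun=> false] C].
have l1M : (size l1 <= M)%N.
  by rewrite size_filter (leq_trans (count_size _ _)) // -cardE.
pose test (u : nat) (v : 'I_M -> bool) : bool :=
  (u <= M)%N && ((count (inC v) l1 == u) && gain_at_least u (inC v)).
pose X := (2 ^ j * j.+1)%N.
have X0 : (0 < X)%N by rewrite muln_gt0 expn_gt0.
have ctest u : computable (M.+1 * (M.+1 * 32) + a * X).+1 (fun v (_ : unit) => test u v).
  rewrite /test; case: (leqP u M) => uM /=; last first.
    by refine (computable_le (@computable_const _ false) _).
  have cin := computable_wire (@enum_rank (kclause n k)).
  have c1 := computable_comp cin (computable_count_eq l1 u).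
  have c := computable_op andb c1 (computable_comp cin (H n u j uM tau_le)).
  refine (computable_le c _); rewrite !add0n ltnS leq_add //; last by rewrite /X mulnA.
  by apply: leq_mul; [rewrite ltnS | rewrite leq_mul2r ltnS uM orbT].
have [C sC HC] := computable_circuit (computable_has (iota 0 M.+1) ctest).
exists C.
  move=> F; rewrite HC ?size_enc_kcnf // [satisfiable F](all_sat_gain (fun C => C \in F)).
  have vF : inC (fun i => nth false (enc_kcnf F) i) = fun C => C \in F.
    by apply/funext => D; exact: nth_enc_kcnf.
  apply/hasP/idP => [|H1]; first by move=> [u _]; rewrite /test vF => /and3P[_ /eqP <-].
  exists (count (fun C => C \in F) l1); last first.
    by rewrite /test vF eqxx H1 (leq_trans (count_size _ _)).
  by rewrite mem_iota /= add0n ltnS (leq_trans (count_size _ _)).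
apply: leq_trans sC _; rewrite size_iota -/X.
have h1 : ((M.+1 * (M.+1 * 32) + a * X).+2 <= (a + (Mb n * (Mb n * 32) + 10)) * X)%N.
  have h32 : (M.+1 * (M.+1 * 32) <= Mb n * (Mb n * 32))%N by rewrite !leq_mul.
  have := leq_pmulr (Mb n * (Mb n * 32) + 10) X0.
  by rewrite mulnDl; lia.
have := leq_mul MMb h1; rewrite (_ : q n * X = Mb n * ((a + (Mb n * (Mb n * 32) + 10)) * X) + 2 * X)%N;
  last by rewrite /q mulnDl -[in LHS]mulnA.
have : (2 <= 2 * X)%N by lia.
by lia.
Qed.

Lemma sat_inf_fast (R : realType) (k : nat) (tau : nat -> R) :
  CVPP_algorithm (@linfnorm R) (1 + (2 * inf_radius k)%:R^-1) tau ->
  fast_circuits tau (sat_correct k).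
Proof.
move=> /all_sat_computable[a [e [ell [ell_poly H]]]].
exists e, (fun=> a.+1), ell; split=> //; first exact: poly_bounded_const.
move=> n j tau_le.
have cin := computable_wire (@enum_rank (kclause n k)).
have [C sC HC] := computable_circuit (computable_comp cin (H n j tau_le)).
exists C.
  move=> F; rewrite HC ?size_enc_kcnf //; congr all_sat.
  by apply/funext => D; exact: nth_enc_kcnf.
apply: leq_trans sC _; rewrite add0n -mulnA mulSn addnC -addn1 leq_add2l.
by rewrite muln_gt0 expn_gt0.
Qed.

(** * Asymptotics *)

(** With x = delta ln 2 / (b+1), the inequality exp(xn) >= xn raised to the power b+1 gives 2^(delta
    n) >= (xn)^(b+1), which has one more factor n than the polynomial. *)
Lemma poly_le_exp (R : realType) (q : nat -> nat) (delta : R) : poly_bounded q -> 0 < delta ->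
  \forall n \near \oo, (q n)%:R <= (2 : R) `^ (delta * n%:R).
Proof.
move=> [a [b Hq]] d0.
have ln2 : 0 < ln (2 : R) by rewrite ln_gt0 // ltr1n.
pose x := delta * ln 2 / b.+1%:R.
have x0 : 0 < x by rewrite divr_gt0 ?mulr_gt0.
have xb0 : 0 < x ^+ b.+1 by rewrite exprn_gt0.
near=> n.
have n1 : (0 < n)%N by near: n; exists 1%N.
have nb : (a * 2 ^ b)%:R / x ^+ b.+1 <= n%:R by near: n; exact: nbhs_infty_ger.
have : (x * n%:R) ^+ b.+1 <= 2 `^ (delta * n%:R).
  rewrite /powR pnatr_eq0 /=.
  have -> : delta * n%:R * ln 2 = (x * n%:R) * b.+1%:R.
    by rewrite /x; field; rewrite addrC natr1 pnatr_eq0.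
  rewrite expRM_natr lerXn2r ?nnegrE ?expR_ge0 //; first by rewrite mulr_ge0 // ltW.
  by apply: le_trans (expR_ge1Dx _); rewrite lerDr.
apply: le_trans; apply: le_trans (_ : (a * 2 ^ b)%:R * n%:R ^+ b <= _).
  rewrite -natrX -natrM ler_nat; apply: leq_trans (Hq n) _.
  rewrite -mulnA leq_mul2l -expnMn; apply/orP; right.
  by case: (b) => // b'; rewrite leq_exp2r // mul2n -addnn; lia.
rewrite exprMn [n%:R ^+ b.+1]exprS mulrA ler_wpM2r ?exprn_ge0 //.
by rewrite [leRHS]mulrC -ler_pdivrMr.
Unshelve. all: by end_near. Qed.

Lemma pow2_cover (R : realType) (x : R) : exists2 j : nat, x <= (2 ^ j)%:R &
  (2 ^ j)%:R <= 2 * Num.max 1 x.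
Proof.
have ex : exists j, `[< x <= (2 ^ j)%:R >].
  exists (Num.bound `|x|); apply/asboolP.
  apply: le_trans (ler_norm _) _; apply: le_trans (ltW (archi_boundP (normr_ge0 x))) _.
  by rewrite ler_nat ltnW // ltn_expl.
case: (ex_minnP ex) => j /asboolP Hj min; exists j => //.
case: j Hj min => [|j] _ min; first by rewrite expn0; have : 1 <= Num.max 1 x by [rewrite le_max lexx]; lra.
have : (2 ^ j)%:R < x.
  by rewrite ltNge; apply/negP => h; have := min j (asboolT h); rewrite ltnn.
rewrite expnS natrM => h; rewrite ler_wpM2l // (le_trans (ltW h)) //.
by rewrite le_max lexx orbT.
Qed.

(** The family is chosen before the exponents: for ETH a single family must have size 2^(dn) for
    every d > 0. *)
Lemma fast_circuits_size (R : realType) (tau : nat -> R) (P : nat -> circuit -> Prop) :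
  fast_circuits tau P ->
  exists2 C : nat -> circuit, (forall n, P n (C n)) &
    forall beta beta' : R, 0 <= beta -> beta < beta' ->
      (\forall n \near \oo, tau n <= 2 `^ (beta * n%:R)) ->
      \forall n \near \oo, (size (C n)).+1%:R <= (2 : R) `^ (beta' * n%:R).
Proof.
move=> [e [q [ell [q_poly ell_poly H]]]].
have /choice[C HC] n : exists C, P n C /\ exists j,
    [/\ (size C <= q n * (2 ^ j * j.+1))%N &
      (2 ^ j)%:R <= 2 * Num.max 1 (tau n * (ell n)%:R ^+ e)].
  have [j h1 h2] := pow2_cover (tau n * (ell n)%:R ^+ e).
  by have [C PC sC] := H n j h1; exists C; split=> //; exists j.
exists C => [n|beta beta' b0 bb' tau_le]; first by have [] := HC n.
pose B := Num.bound beta.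
have bB : beta <= B%:R by apply/ltW/archi_boundP.
pose E n := ((ell n) ^ e + 1)%N.
(* The factor [2 * E n] accounts for the polynomial part of the running time and the rounding to a
   power of 2; the last factor bounds [j + 1]. *)
pose Q n := (q n * (2 * E n * (2 + B * n.+1 + E n)) + 1)%N.
have cst := poly_bounded_const; have mul := poly_bounded_mul; have add := poly_bounded_add.
have E_poly : poly_bounded E by exact: (add _ _ (poly_bounded_exp e ell_poly) (cst 1%N)).
have Q_poly : poly_bounded Q.
  have H1 := add _ _ (add _ _ (cst 2%N) (mul _ _ (cst B) poly_bounded_succ)) E_poly.
  exact: (add _ _ (mul _ _ q_poly (mul _ _ (mul _ _ (cst 2%N) E_poly) H1)) (cst 1%N)).
have d0 : 0 < beta' - beta by rewrite subr_gt0.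
have Qexp := poly_le_exp Q_poly d0.
near=> n.
have tn : tau n <= 2 `^ (beta * n%:R) by near: n.
have Qn : (Q n)%:R <= (2 : R) `^ ((beta' - beta) * n%:R) by near: n.
have [_ [j [sC hj]]] := HC n.
set T : R := 2 `^ (beta * n%:R) in tn.
have T1 : 1 <= T.
  rewrite /T -[leLHS](powRr0 (2 : R)); apply: ler_powR; first by rewrite ler1n.
  by rewrite mulr_ge0.
have TE : (2 ^ j)%:R <= 2 * (T * (E n)%:R).
  apply: le_trans hj _; rewrite ler_wpM2l // ge_max; apply/andP; split.
    by apply: mulr_ege1 => //; rewrite ler1n /E addn1.
  rewrite /E natrD natrX mulrDr mulr1; apply: le_trans (_ : T * (ell n)%:R ^+ e <= _).
    by rewrite ler_wpM2r // exprn_ge0.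
  by rewrite lerDl (le_trans ler01).
have jle : (j <= 1 + B * n + E n)%N.
  rewrite -(@leq_exp2l 2) // -(ler_nat R); apply: le_trans TE _.
  rewrite expnD (expnD 2 1) 2!natrM expn1 -mulrA ler_wpM2l // ler_pM //; first exact: powR_ge0.
    rewrite natrX -powR_mulrn // natrM; apply: ler_powR; first by rewrite ler1n.
    by rewrite ler_wpM2r.
  by rewrite ler_nat ltnW // ltn_expl.
have -> : beta' * n%:R = beta * n%:R + (beta' - beta) * n%:R by ring.
rewrite powRD ?pnatr_eq0 ?implybT // -/T.
apply: le_trans (ler_wpM2l (le_trans ler01 T1) Qn).
apply: (@le_trans _ _ (q n * (2 ^ j * j.+1) + 1)%:R); first by rewrite ler_nat addn1 ltnS.
have main : (2 ^ j * j.+1)%:R <= T * (2 * E n * (2 + B * n.+1 + E n))%:R.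
  rewrite natrM; have -> : T * (2 * E n * (2 + B * n.+1 + E n))%:R =
      2 * (T * (E n)%:R) * (2 + B * n.+1 + E n)%:R by rewrite !natrM; ring.
  by rewrite ler_pM // ler_nat mulnS; lia.
rewrite /Q natrD [in leRHS]natrD mulrDr mulr1 lerD //.
by rewrite natrM [in leRHS]natrM mulrCA ler_wpM2l.
Unshelve. all: by end_near. Qed.

(** Half of the saving is given up to absorb the polynomial and logarithmic factors. The minimum
    with 1 keeps the exponent non-negative when [eps > 1]. *)
Lemma seth_contra (R : realType) (solves : nat -> (nat -> circuit) -> Prop)
    (P : forall k n : nat, circuit -> Prop) (eps : R) (k : nat) :
  (forall k C, solves k C <-> forall n, P k n (C n)) -> 0 < eps ->
  (~ exists C : nat -> circuit, solves k C /\ \forall n \near \oo,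
     (size (C n))%:R <= (2 : R) `^ ((1 - Num.min eps 1 / 2) * n%:R)) ->
  ~ fast_circuits (fun n => (2 : R) `^ ((1 - eps) * n%:R)) (P k).
Proof.
move=> HP e0 hard /fast_circuits_size[C PC sC]; apply: hard; exists C; split; first exact/HP.
have m0 : 0 < Num.min eps 1 by rewrite lt_min e0 ltr01.
have m1 : Num.min eps 1 <= 1 by rewrite ge_min lexx orbT.
have me : Num.min eps 1 <= eps by rewrite ge_min lexx.
have : \forall n \near \oo, (2 : R) `^ ((1 - eps) * n%:R) <= 2 `^ ((1 - Num.min eps 1) * n%:R).
  near=> n; apply: ler_powR; first by rewrite ler1n.
  by rewrite ler_wpM2r // lerB.
move: (Num.min eps 1) m0 m1 me => m m0 m1 me tau_le.
have := sC (1 - m) (1 - m / 2) _ _ tau_le.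
move=> /(_ ltac:(lra) ltac:(lra)); apply: filterS => n; apply: le_trans.
by rewrite ler_nat.
Unshelve. all: by end_near. Qed.

Lemma eth_contra (R : realType) (solves : nat -> (nat -> circuit) -> Prop)
    (P : forall k n : nat, circuit -> Prop) (tau : nat -> R) :
  (forall k C, solves k C <-> forall n, P k n (C n)) ->
  eth_for R solves -> is_two_pow_o tau -> ~ fast_circuits tau (P 3%N).
Proof.
move=> HP hard [f [f0 tauE]] /fast_circuits_size[C PC sC]; apply: hard.
have ln2 : 0 < ln (2 : R) by rewrite ln_gt0 // ltr1n.
have tau_le (d : R) : 0 < d -> \forall n \near \oo, tau n <= 2 `^ (d * n%:R).
  move=> d0; move/cvgrPdist_le: f0 => /(_ d d0) f0.
  near=> n; rewrite tauE; apply: ler_powR; first by rewrite ler1n.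
  have n0 : (0 : R) < n%:R by rewrite ltr0n; near: n; exists 1%N.
  have : `|0 - f n / n%:R| <= d by near: n.
  rewrite sub0r normrN => /(le_trans (ler_norm _)).
  by rewrite ler_pdivrMr.
(* The exponent o(n) is read off the family itself; the successor keeps the logarithm defined and
   non-negative for an empty circuit. *)
pose g n : R := ln (size (C n)).+1%:R / ln 2.
exists C, (fun n => 2 `^ g n); split; first exact/HP; last first.
  move=> n; rewrite /powR pnatr_eq0 /= /g divfK ?gt_eqF // lnK ?posrE ?ltr0n // ler_nat.
  exact: leqnSn.
exists g; split=> //; apply/cvgrPdist_le => d d0.
have d2 : 0 < d / 2 by rewrite divr_gt0.
have := sC (d / 2) d (ltW d2) _ (tau_le _ d2); move=> /(_ ltac:(lra)) sz.
near=> n.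
have n0 : (0 : R) < n%:R by rewrite ltr0n; near: n; exists 1%N.
have g0 : 0 <= g n by rewrite divr_ge0 ?ln_ge0 ?ler1n // ltW.
rewrite sub0r normrN ger0_norm; last exact: (divr_ge0 g0 (ltW n0)).
rewrite ler_pdivrMr // /g ler_pdivrMr // -ln_powR ler_ln ?posrE ?ltr0n ?powR_gt0 //.
by near: n.
Unshelve. all: by end_near. Qed.

Lemma clause_gadget_three (R : realType) (p : R) : 1 <= p -> p <> 2 -> clause_gadget p 3.
Proof.
move=> p1 p2; have [[m pm]|] := pselect (exists m : int, p = 2 * m%:~R); last first.
  exact: clause_gadget_noneven.
have m0 : 0 < m by rewrite -(ltr0z R); lra.
have m1 : m != 1 by apply/eqP => m1; apply: p2; rewrite pm m1 mulr1.
have -> : p = (2 * `|m|%N)%:R by rewrite natrM pm natr_absz ger0_norm // ltW.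
by apply: clause_gadget_even; lia.
Qed.

Theorem theorem5p1 (R : realType) :
  (forall p eps : R, 1 <= p -> ~ (exists m : int, p = 2 * m%:~R) -> 0 < eps ->
     (MaxSAT_SETH R ->
        ~ CVPP_algorithm (@lpnorm R p) 1 (fun n => 2 `^ ((1 - eps) * n%:R))) /\
     (SETH R ->
        ~ CVPP_algorithm (@lpnorm R p) 1 (fun n => 2 `^ ((1 - eps) * n%:R)))) /\
  (forall p : R, 1 <= p -> p <> 2 ->
     (MaxSAT_ETH R ->
        ~ (exists tau : nat -> R,
             is_two_pow_o tau /\ CVPP_algorithm (@lpnorm R p) 1 tau)) /\
     (ETH R ->
        ~ (exists tau : nat -> R,
             is_two_pow_o tau /\ CVPP_algorithm (@lpnorm R p) 1 tau))) /\
  (forall eps : R, 0 < eps ->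
     exists gamma : R, 1 < gamma /\
       (SETH R ->
          ~ CVPP_algorithm (@linfnorm R) gamma (fun n => 2 `^ ((1 - eps) * n%:R)))).
Proof.
have maxP k C : solves_MaxkSAT k C <-> forall n, maxsat_correct k n (C n) by [].
have satP k C : solves_kSAT k C <-> forall n, sat_correct k n (C n) by [].
have half (eps : R) : 0 < eps -> 0 < Num.min eps 1 / 2.
  by move=> e0; rewrite divr_gt0 // lt_min e0 ltr01.
split; [|split].
- move=> p eps p1 pne e0; split=> /(_ _ (half _ e0))[k hard] alg.
    apply: (seth_contra maxP e0 hard); apply: maxsat_fast alg => //.
    exact: clause_gadget_noneven.
  apply: (seth_contra satP e0 hard); apply: sat_fast alg => //.
  exact: clause_gadget_noneven.
- move=> p p1 p2; have gad := clause_gadget_three p1 p2.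
  split=> hard [tau [tau_o alg]].
    exact: (eth_contra maxP hard tau_o (maxsat_fast p1 gad alg)).
  exact: (eth_contra satP hard tau_o (sat_fast p1 gad alg)).
(* The factor depends on the clause width [k] provided by SETH, yet it must be named before SETH is
   assumed; hence the case distinction, with an arbitrary factor if SETH fails. *)
move=> eps e0; have [seth|nseth] := pselect (SETH R); last by exists 2; rewrite ltr1n.
have [k hard] := seth _ (half _ e0).
exists (1 + (2 * inf_radius k)%:R^-1); split.
  by rewrite ltrDl invr_gt0 ltr0n muln_gt0 /inf_radius muln_gt0 expn_gt0.
by move=> _ /sat_inf_fast; exact: (seth_contra satP e0 hard).
Qed.
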